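(* Let the positive integer $m$ and the real numbers $\alpha,\gamma$ be such that $$1\le m\le N,\qquad 0<\gamma<N,\qquad 0<\alpha<\frac2{\gamma+m}.$$ Suppose that $\varphi\in L^1_{\rm loc}(\mathbb R^N\setminus\{0\})$ is anti-symmetric with respect to $x_1,x_2,\dots,x_m$, that $\varphi_{|\Omega_m}\in\mathcal X$, that $\varphi\ge0$ in $\Omega_m$, and that $\varphi(x)\ge\omega(x)\psi_0(x)$ for $x\in\Omega_m\cap\{|x|\ge R\}$, for some $R>0$, where $\omega\in L^\infty(\mathbb R^N)$ is homogeneous of degree $0$, anti-symmetric with respect to $x_1,\dots,x_m$, $\omega\ge0$ on $\Omega_m$ and $\omega\not\equiv0$. Then, for the equation $\partial_tu=\Delta u+|u|^\alpha u$ on $\mathbb R^N$ with $u(0)=\lambda\varphi$, one has $T_{\max}(\lambda\varphi)<\infty$ for all $\lambda>0$ and $$\limsup_{\lambda\to0}\lambda^{\left(\frac1\alpha-\frac{\gamma+m}2\right)^{-1}}T_{\max}(\lambda\varphi)\ \le\ \frac1{\left(\alpha^{1/\alpha}\left\|e^{\Delta_m}(\omega\psi_0)\right\|_\infty\right)^{\left(\frac1\alpha-\frac{\gamma+m}2\right)^{-1}}} .$$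
   Context: $\Omega_m=\{x\in\mathbb R^N: x_1>0,\dots,x_m>0\}$. The function $\psi_0:\Omega_m\to\mathbb R$ is $\psi_0(x)=c_{m,\gamma}\,x_1\cdots x_m\,|x|^{-\gamma-2m}$ with $c_{m,\gamma}=\gamma(\gamma+2)\cdots(\gamma+2m-2)$, and $\mathcal X=\{\psi\in L^1_{\rm loc}(\Omega_m):\ \psi/\psi_0\in L^\infty(\Omega_m)\}$. A function is anti-symmetric with respect to $x_1,\dots,x_m$ if for each $i\le m$ it changes sign under the reflection $x_i\mapsto-x_i$. $e^{t\Delta_m}$ is the (Dirichlet) heat semigroup on $\Omega_m$, with kernel $\prod_{i=1}^m\big(g_t(x_i-y_i)-g_t(x_i+y_i)\big)\prod_{i=m+1}^Ng_t(x_i-y_i)$, $g_t(s)=(4\pi t)^{-1/2}e^{-s^2/4t}$; $e^{\Delta_m}$ is its value at $t=1$ and $\|\cdot\|_\infty$ here is the norm of $L^\infty(\Omega_m)$. For $u_0=\lambda\varphi$ with $\lambda>0$ and $\varphi\in L^1_{\rm loc}(\mathbb R^N\setminus\{0\})$ anti-symmetric with respect to $x_1,\dots,x_m$, $\varphi_{|\Omega_m}\in\mathcal X$, $\varphi\ge0$ in $\Omega_m$ (where $1\le m\le N$, $0<\gamma<N$, $0<\alpha<\frac2{\gamma+m}$), the Cauchy problem $\partial_tu=\Delta u+|u|^\alpha u$ on $\mathbb R^N$, $u(0)=u_0$, is known to be locally well-posed in the class of anti-symmetric functions, and the solution extends to a maximal solution $u:(0,T_{\max}(u_0))\to C_0(\mathbb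 R^N)$, anti-symmetric with respect to $x_1,\dots,x_m$, whose restriction to $\Omega_m$ is nonnegative and satisfies $u(t)=e^{t\Delta_m}u_0+\int_0^te^{(t-\sigma)\Delta_m}[|u(\sigma)|^\alpha u(\sigma)]\,d\sigma$; $T_{\max}(u_0)$ is its existence time. $C_0(\mathbb R^N)$ is the space of continuous functions vanishing at infinity. *)

(* Defs.v *)
From HB Require Import structures.
From mathcomp Require Import all_boot all_order all_algebra.
From mathcomp Require Import all_classical all_reals all_analysis.

Set Implicit Arguments.
Unset Strict Implicit.
Unset Printing Implicit Defensive.

Import Order.TTheory GRing.Theory Num.Theory.
Import numFieldNormedType.Exports.

Local Open Scope classical_set_scope.
Local Open Scope ring_scope.

(* 'rV[T]_n with the product sigma-algebra (the Borel sets when T is R) *)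
Definition rV_display : measure_display -> measure_display.
Proof. exact. Qed.

Section measurable_rV.
Context {d} {T : sigmaRingType d} (n : nat).

Let coord (i : 'I_n) (x : 'rV[T]_n) : T := x ord0 i.

Let rV_set0 : g_sigma_preimage coord set0.
Proof. exact: sigma_algebra0. Qed.

Let rV_setC A : g_sigma_preimage coord A -> g_sigma_preimage coord (~` A).
Proof. exact: sigma_algebraC. Qed.

Let rV_bigcup (F : _^nat) : (forall i, g_sigma_preimage coord (F i)) ->
  g_sigma_preimage coord (\bigcup_i (F i)).
Proof. exact: sigma_algebra_bigcup. Qed.

HB.instance Definition _ := @isMeasurable.Build (rV_display d)
  'rV[T]_n (g_sigma_preimage coord) rV_set0 rV_setC rV_bigcup.

End measurable_rV.

Section measurable_coord.
Context d (T : measurableType d).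

Lemma measurable_coord n (i : 'I_n) :
  measurable_fun [set: 'rV[T]_n] (fun x : 'rV[T]_n => x ord0 i).
Proof.
move=> _ Y mY; rewrite setTI; apply: sub_sigma_algebra => /=.
rewrite -bigcup_seq/=; exists i => /=; first by rewrite mem_index_enum.
by exists Y => //; rewrite setTI.
Qed.

Lemma measurable_fun_rV d' (T' : measurableType d') n (f : T' -> 'rV[T]_n) :
  (forall i, measurable_fun [set: T'] (fun x => f x ord0 i)) ->
  measurable_fun [set: T'] f.
Proof.
move=> mf _ Y mY.
have : (fun B => measurable ([set: T'] `&` f @^-1` B)) Y.
  have S : sigma_algebra setT [set B | measurable ([set: T'] `&` f @^-1` B)].
    split => /=.
    - by rewrite preimage_set0 setI0.
    - move=> A; rewrite !setTI setTD => mA.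
      by rewrite preimage_setC; exact: measurableC.
    - move=> F; rewrite setTI => mF; rewrite preimage_bigcup.
      by apply: bigcupT_measurable => k; rewrite -[X in measurable X]setTI.
  have := mY => /(_ [set B | measurable ([set: T'] `&` f @^-1` B)]); apply.
  split => // B /=; rewrite -bigcup_seq/= => -[i _ [C mC <-]].
  by rewrite setTI; exact: mf.
by [].
Qed.

End measurable_coord.

Section lebesgue_rV.
Context (R : realType).

Definition rV_cons n (p : R * 'rV[R]_n) : 'rV[R]_n.+1 :=
  \row_i (if unlift ord0 i is Some j then p.2 ord0 j else p.1).

Definition rV_behead n (x : 'rV[R]_n.+1) : 'rV[R]_n :=
  \row_j x ord0 (lift ord0 j).

Lemma measurable_rV_cons n : measurable_fun setT (@rV_cons n).
Proof.
apply: measurable_fun_rV => i.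
have [j ->|->] := unliftP ord0 i.
  rewrite (_ : (fun _ => _) = (fun x : 'rV[R]_n => x ord0 j) \o snd).
    by apply: measurableT_comp => //; exact: measurable_coord.
  by apply/funext => x /=; rewrite mxE liftK.
rewrite (_ : (fun _ => _) = fst)//.
by apply/funext => x /=; rewrite mxE unlift_none.
Qed.

Lemma measurable_rV_behead n : measurable_fun setT (@rV_behead n).
Proof.
apply: measurable_fun_rV => i.
rewrite (_ : (fun _ => _) = fun x : 'rV[R]_n.+1 => x ord0 (lift ord0 i)).
  exact: measurable_coord.
by apply/funext => x; rewrite mxE.
Qed.

Section step.
Variables (n : nat) (mu : {sigma_finite_measure set 'rV[R]_n -> \bar R}).
Local Open Scope ereal_scope.

Definition lebesgue_rVS : set 'rV[R]_n.+1 -> \bar R :=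
  pushforward (@lebesgue_measure R \x mu) (@rV_cons n).

Let lebesgue_rVS0 : lebesgue_rVS set0 = 0.
Proof. by rewrite /lebesgue_rVS /pushforward preimage_set0 measure0. Qed.

Let lebesgue_rVS_ge0 A : 0 <= lebesgue_rVS A.
Proof. exact: integral_ge0. Qed.

Let lebesgue_rVS_sigma_additive : semi_sigma_additive lebesgue_rVS.
Proof.
have mcons := @measurable_rV_cons n.
move=> F mF tF mUF; rewrite /lebesgue_rVS /pushforward preimage_bigcup.
apply: measure_semi_sigma_additive.
- by move=> k; rewrite -[X in measurable X]setTI; exact: mcons.
- apply/trivIsetP => /= i j _ _ ij; rewrite -preimage_setI.
  by move/trivIsetP : tF => /(_ _ _ _ _ ij) ->//; rewrite preimage_set0.
- by rewrite -preimage_bigcup -[X in measurable X]setTI; exact: mcons.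
Qed.

HB.instance Definition _ := isMeasure.Build _ _ _ lebesgue_rVS
  lebesgue_rVS0 lebesgue_rVS_ge0 lebesgue_rVS_sigma_additive.

Lemma lebesgue_rVSE (A : set R) (B : set 'rV[R]_n) :
  measurable A -> measurable B ->
  lebesgue_rVS [set x : 'rV[R]_n.+1 | A (x ord0 ord0) /\ B (rV_behead x)] =
  lebesgue_measure A * mu B.
Proof.
move=> mA mB; rewrite -product_measure1E//; congr (_ \x _).
apply/seteqP; split => -[a v] /=; rewrite mxE unlift_none /=;
  rewrite (_ : rV_behead _ = v)//; apply/rowP => j; rewrite !mxE;
  by rewrite liftK.
Qed.

Let lebesgue_rVS_sigma_finite : sigma_finite setT lebesgue_rVS.
Proof.
have /sigma_finiteP[F [TF ndF Foo]] := sigma_finiteT (@lebesgue_measure R).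
have /sigma_finiteP[G [TG ndG Goo]] := sigma_finiteT mu.
exists (fun k => [set x : 'rV[R]_n.+1 | F k (x ord0 ord0) /\ G k (rV_behead x)]).
  apply/seteqP; split=> // x _.
  have : [set: R] (x ord0 ord0) by [].
  have : [set: 'rV[R]_n] (rV_behead x) by [].
  rewrite TF TG => -[i _ Gi] [j _ Fj].
  exists (maxn i j) => //; split.
  - by move: Fj; exact/subsetPset/ndF/leq_maxr.
  - by move: Gi; exact/subsetPset/ndG/leq_maxl.
move=> k; have [mF Fk] := Foo k; have [mG Gk] := Goo k; split; last first.
  by rewrite lebesgue_rVSE// lte_mul_pinfty// ge0_fin_numE.
apply: measurableI.
- by rewrite -[X in measurable X]setTI; exact: measurable_coord.
- by rewrite -[X in measurable X]setTI; exact: measurable_rV_behead.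
Qed.

HB.instance Definition _ := Measure_isSigmaFinite.Build _ _ _ lebesgue_rVS
  lebesgue_rVS_sigma_finite.

End step.

Fixpoint lebesgue_rV n : {sigma_finite_measure set 'rV[R]_n -> \bar R} :=
  if n is k.+1 return {sigma_finite_measure set 'rV[R]_n -> \bar R}
  then lebesgue_rVS (lebesgue_rV k) else \d_(0 : 'rV[R]_0).

Lemma lebesgue_rV_box n (A : 'I_n -> set R) : (forall i, measurable (A i)) ->
  lebesgue_rV n [set x : 'rV[R]_n | forall i, A i (x ord0 i)] =
  (\prod_(i < n) lebesgue_measure (A i))%E.
Proof.
elim: n A => [|n IH] A mA /=.
  by rewrite big_ord0 diracE mem_set// => -[].
rewrite big_ord_recl -IH// -lebesgue_rVSE//; last first.
  rewrite (_ : mkset _ =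
      \bigcap_(i in [set: 'I_n]) (fun x : 'rV[R]_n => x ord0 i) @^-1` A (lift ord0 i)).
    apply: fin_bigcap_measurable => // i _.
    by rewrite -[X in measurable X]setTI; exact: measurable_coord.
  by apply/seteqP; split => x /= Ax i; [move=> _|]; exact: Ax.
congr (lebesgue_rVS _ _); apply/seteqP; split => x /= => [Ax|[A0 Ax] i].
  by split => // i; rewrite mxE; exact: Ax.
by have [j ->|->//] := unliftP ord0 i; have := Ax j; rewrite mxE.
Qed.

End lebesgue_rV.
Arguments lebesgue_rV {R n}.

Section heat_equation.
Context (R : realType) (N : nat).
Implicit Types (x y : 'rV[R]_N) (f : 'rV[R]_N -> R).

Local Notation mu := (@lebesgue_rV R N).

(* The library norm `|x| on 'rV[R]_N is the sup norm. *)
Definition eucl x : R := Num.sqrt (\sum_i x ord0 i ^+ 2).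

Definition Omega (m : nat) : set 'rV[R]_N :=
  [set x | forall i : 'I_N, (i < m)%N -> 0 < x ord0 i].

Definition reflection (i : 'I_N) x : 'rV[R]_N :=
  \row_j (if j == i then - x ord0 j else x ord0 j).

Definition anti_symmetric m f :=
  forall i : 'I_N, (i < m)%N -> forall x, f (reflection i x) = - f x.

(* For elements of Lebesgue spaces, pointwise relations are understood
   almost everywhere. *)
Definition ae_anti_symmetric m f :=
  forall i : 'I_N, (i < m)%N -> {ae mu, forall x, f (reflection i x) = - f x}.

Definition ae_homogeneous0 f :=
  forall r : R, 0 < r -> {ae mu, forall x, f (r *: x) = f x}.

(* [locally_integrable] of the library, which is restricted to the line *)
Definition L1loc (D : set 'rV[R]_N) f :=
  [/\ measurable_fun D f, open D &
      forall K, K `<=` D -> compact K ->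
        (\int[mu]_(x in K) `|f x|%:E < +oo)%E].

Definition Linfty_norm (D : set 'rV[R]_N) (f : 'rV[R]_N -> \bar R) : \bar R :=
  Lnorm mu +oo%E (f \_ D).

Definition Linfty (D : set 'rV[R]_N) f :=
  measurable_fun D f /\ (Linfty_norm D (EFin \o f) < +oo)%E.

Definition psi0 (m : nat) (gamma : R) x : R :=
  (\prod_(k < m) (gamma + 2 * k%:R)) *
  (\prod_(i < N | (i < m)%N) x ord0 i) *
  eucl x `^ (- gamma - 2 * m%:R).

Definition calX (m : nat) (gamma : R) f :=
  L1loc (Omega m) f /\ Linfty (Omega m) (fun x => f x / psi0 m gamma x).

Definition gauss (t s : R) : R :=
  (Num.sqrt (4 * pi * t))^-1 * expR (- (s ^+ 2 / (4 * t))).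

Definition heat_kernel (m : nat) (t : R) x y : R :=
  \prod_(i < N)
    if (i < m)%N
    then gauss t (x ord0 i - y ord0 i) - gauss t (x ord0 i + y ord0 i)
    else gauss t (x ord0 i - y ord0 i).

Definition heat_semigroup (m : nat) (t : R) f x : \bar R :=
  (\int[mu]_(y in Omega m) (heat_kernel m t x y * f y)%:E)%E.

Definition C0 f :=
  continuous f /\
  forall e : R, 0 < e -> exists r : R, forall x, r <= eucl x -> `|f x| <= e.

Definition is_solution (m : nat) (alpha : R) (u0 : 'rV[R]_N -> R) (T : R)
    (u : R -> 'rV[R]_N -> R) :=
  forall t : R, 0 < t < T ->
  [/\ C0 (u t),
      {uniform, u s @[s --> t] --> u t},
      anti_symmetric m (u t),
      forall x, Omega m x -> 0 <= u t x &
      forall x, Omega m x ->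
        (u t x)%:E = (heat_semigroup m t u0 x +
          \int[lebesgue_measure]_(s in `]0%R, t[)
            heat_semigroup m (t - s)
              (fun y => `|u s y| `^ alpha * u s y)%R x)%E].

(* [is_solution] does not restrict to the space in which the fixed point
   argument gives uniqueness, but every nonnegative solution dominates the
   minimal one (the limit of the monotone Picard iterates), which is the
   well-posed one; hence the supremum below is its maximal existence time.
   The set contains 0, as [is_solution] is vacuous for T = 0. *)
Definition Tmax (m : nat) (alpha : R) (u0 : 'rV[R]_N -> R) : \bar R :=
  ereal_sup [set T%:E | T in
    [set T : R | 0 <= T /\ exists u, is_solution m alpha u0 T u]].

End heat_equation.
Arguments Omega {R N} m.

(* Main.v *)
(* Weissler's argument. Fix x in Omega_m and t < T, and let S be the Dirichlet
   heat semigroup of Omega_m. For a nonnegative solution u on (0, T), the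
   semigroup property applied to Duhamel's formula shows that
   h(s) = [S(t - s) u(s)](x) equals A + int_0^s [S(t - r) u(r)^(1+alpha)](x) dr
   with A = [S(t) u0](x), and Jensen's inequality for the sub-Markovian kernel
   gives h(s) >= A + int_0^s h^(1+alpha). As h stays finite up to time t, this
   forces alpha t A^alpha <= 1. For u0 = lambda phi, the parabolic scaling
   x -> sqrt t x, under which omega psi0 is homogeneous of degree -(gamma + m),
   bounds A from below by lambda t^(-(gamma+m)/2) c for large t, where
   c < [S(1) (omega psi0)](x) is arbitrary, so that
   t <= (lambda alpha^(1/alpha) c)^(-1/beta). *)

Require Import Defs.
From HB Require Import structures.
From mathcomp Require Import all_boot all_order all_algebra.
From mathcomp Require Import all_classical all_reals all_analysis.
From mathcomp Require Import measurable_realfun ess_sup_inf ring lra.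

Set Implicit Arguments.
Unset Strict Implicit.
Unset Printing Implicit Defensive.

Import Order.TTheory GRing.Theory Num.Theory.
Import numFieldNormedType.Exports.

Local Open Scope classical_set_scope.
Local Open Scope ring_scope.

(** * The Gaussian and the Dirichlet heat kernel on a half-line *)

Section line.
Context {R : realType}.
Implicit Types (b : bool) (a c s t : R).

Local Notation leb := (@lebesgue_measure R).

(** The condition alpha < 2/(gamma + m) says that beta = 1/alpha - (gamma + m)/2 is positive. With
    the lower bound on A, the inequality alpha t A^alpha <= 1 becomes t^(alpha beta) <= const
    lambda^(-alpha), which limits t from above exactly because beta > 0. The time from which that
    lower bound holds does not depend on lambda, as lambda only multiplies the datum; when lambda
    tends to 0, lambda^(-1/beta) outgrows it, so only the behaviour of phi at infinity enters the
    limit. The product formula of the kernel changes sign off Omega_m, and no integrability of the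
    Duhamel term is assumed beforehand. A kernel extended by 0 and absolute values make every
    integrand nonnegative everywhere, so that exchanging integrals rests on Tonelli's theorem alone,
    with values in [0, +oo]; finiteness is read off from u(t, x) being a real number. The joint
    measurability that Tonelli requires comes from the continuity of u in x and in t. *)

Lemma ge0_integral_scale_line (k : R) (f : R -> \bar R) : k != 0 ->
  measurable_fun setT f -> (forall x, 0 <= f x)%E ->
  (\int[leb]_x f (k * x)%R = (`|k|^-1)%:E * \int[leb]_x f x)%E.
Proof.
move=> k0 mf f0.
have mk : measurable_fun setT (fun x : measurableTypeR R => k * x : measurableTypeR R).
  exact: measurable_funM.
have nk0 : 0 < `|k| by rewrite normr_gt0.
(* Lebesgue measure is characterised by its values on half-open intervals; a negative [k] turns such
   an interval into one closed at the other end, of the same length up to the factor. *)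
have @nu : {measure set (measurableTypeR R) -> \bar R}.
  refine (mscale (NngNum (ltW nk0)) (pushforward leb
    (fun x : measurableTypeR R => k * x : measurableTypeR R))).
  exact: mk.
have nuE B : nu B = (`|k|%:E * leb ((fun x => (k * x)%R) @^-1` B))%E by [].
have E A : measurable A -> leb A = nu A.
  apply: lebesgue_measure_unique => _ [[u v]] _ <-.
  rewrite nuE.
  have [kgt0|klt0] := ltP 0 k.
    rewrite (_ : _ @^-1` _ = `]u / k, v / k]%classic); last first.
      apply/seteqP; split => x /=; rewrite !in_itv/= ltr_pdivrMr// ler_pdivlMr//;
        by rewrite mulrC.
    rewrite !lebesgue_measure_itv/= !lte_fin ltr_pM2r ?invr_gt0//.
    case: ifP => _; last by rewrite mule0.
    by rewrite gtr0_norm// -!EFinD -EFinM -mulrBl mulrCA divff// mulr1.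
  have {klt0}kl0 : k < 0 by rewrite lt_neqAle k0.
  rewrite (_ : _ @^-1` _ = `[v / k, u / k[%classic); last first.
    apply/seteqP; split => x /=; rewrite !in_itv/= ltr_ndivlMr// ler_ndivrMr//;
      by rewrite mulrC andbC.
  rewrite !lebesgue_measure_itv/= !lte_fin ltr_nM2r ?invr_lt0//.
  case: ifP => _; last by rewrite mule0.
  by rewrite ltr0_norm// -!EFinD -EFinM -mulrBl mulrCA mulNr divff// mulrN1 opprB.
rewrite [in RHS](@eq_measure_integral _ _ _ _ nu)//; last by move=> A mA _; exact: E.
rewrite /nu ge0_integral_mscale//= ge0_integral_pushforward//=.
by rewrite muleA -EFinM mulVf ?mul1e ?gt_eqF.
Qed.

Lemma gauss_ge0 t s : 0 <= gauss t s.
Proof. by rewrite mulr_ge0 ?expR_ge0// invr_ge0 sqrtr_ge0. Qed.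

Lemma gauss_gt0 t s : 0 < t -> 0 < gauss t s.
Proof.
by move=> t0; rewrite mulr_gt0 ?expR_gt0// invr_gt0 sqrtr_gt0 !mulr_gt0// pi_gt0.
Qed.

(** Both [Num.sqrt] and the inverse default to 0 here, so the comparison and measurability lemmas
    below hold for all times. *)
Lemma gauss_le0 t s : t <= 0 -> gauss t s = 0.
Proof.
move=> t0; rewrite /gauss ler0_sqrtr ?invr0 ?mul0r//.
by rewrite mulr_ge0_le0// mulr_ge0// pi_ge0.
Qed.

Lemma gaussN t s : gauss t (- s) = gauss t s.
Proof. by rewrite /gauss sqrrN. Qed.

Lemma ler_gauss t a c : `|a| <= `|c| -> gauss t c <= gauss t a.
Proof.
move=> ab; have [t0|t0] := ltP 0 t; last by rewrite !gauss_le0.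
rewrite ler_wpM2l ?invr_ge0 ?sqrtr_ge0// ler_expR lerN2.
rewrite ler_pM2r ?invr_gt0 ?mulr_gt0//.
by rewrite -(real_normK (num_real a)) -(real_normK (num_real c)) lerXn2r// nnegrE.
Qed.

Lemma ltr_gauss t a c : 0 < t -> `|a| < `|c| -> gauss t c < gauss t a.
Proof.
move=> t0 ab.
rewrite ltr_pM2l ?invr_gt0 ?sqrtr_gt0 ?mulr_gt0 ?pi_gt0//.
rewrite ltr_expR ltrN2 ltr_pM2r ?invr_gt0 ?mulr_gt0//.
rewrite -(real_normK (num_real a)) -(real_normK (num_real c)).
by rewrite ltrXn2r// ?nnegrE ?(le_lt_trans _ ab).
Qed.

Lemma gauss_normal_pdf t a c : 0 < t ->
  gauss t (a - c) = normal_pdf a (Num.sqrt (2 * t)) c.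
Proof.
move=> t0; have t2 : 0 < 2 * t by rewrite mulr_gt0.
rewrite normal_pdfE ?gt_eqF ?sqrtr_gt0// /gauss /normal_peak /normal_fun.
rewrite sqr_sqrtr ?ltW//; congr (_^-1 * expR _).
  by congr Num.sqrt; ring.
by rewrite (_ : (2 * t) *+ 2 = 4 * t) 1?mulNr; [congr (- (_ / _)); ring|ring].
Qed.

Lemma measurable_gauss d' (T : measurableType d') (tau xi : T -> R) :
  measurable_fun setT tau -> measurable_fun setT xi ->
  measurable_fun setT (fun w => gauss (tau w) (xi w)).
Proof.
move=> mtau mxi.
(* The square root and the inverses become real powers, which are measurable. *)
rewrite (_ : (fun _ => _) = fun w => if 0 < tau w then
    (4 * pi * tau w) `^ (- 2^-1) * expR (- (xi w ^+ 2 * (4 * tau w) `^ (-1)))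
  else 0); last first.
  apply/funext => w; case: ifPn => [t0|]; last by rewrite -leNgt => /gauss_le0 ->.
  rewrite /gauss powRN powR12_sqrt ?mulr_ge0 ?pi_ge0 ?ltW//.
  by rewrite powRN powRr1// mulr_ge0// ltW.
apply: measurable_fun_if => //.
- exact: measurable_fun_ltr.
- apply: measurable_funTS; apply: measurable_funM.
    apply: (measurableT_comp (measurable_powR _)) => //.
    exact: measurable_funM.
  apply: measurableT_comp => //; apply: measurableT_comp => //.
  apply: measurable_funM; first exact: measurable_funX.
  apply: (measurableT_comp (measurable_powR _)) => //.
  exact: measurable_funM.
Qed.

Let mgauss t (f : R -> R) : measurable_fun setT f ->
  measurable_fun setT (fun x => (gauss t (f x))%:E).
Proof. by move=> mf; apply/measurable_EFinP; exact: measurable_gauss. Qed.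

Lemma integral_gauss t a : 0 < t -> (\int[leb]_x (gauss t (a - x))%:E = 1)%E.
Proof.
move=> t0; rewrite -[RHS](integral_normal_pdf a (Num.sqrt (2 * t))).
by apply: eq_integral => x _; rewrite gauss_normal_pdf.
Qed.

(** Completing the square in [z]: what remains is a Gaussian in [z] about a weighted mean times a
    factor free of [z], so the convolution reduces to total mass 1. *)
Lemma gauss_mul s t a c z : 0 < s -> 0 < t ->
  gauss s (a - z) * gauss t (z - c) =
  gauss (s + t) (a - c) *
  gauss (s * t / (s + t)) ((t * a + s * c) / (s + t) - z).
Proof.
move=> s0 t0; have st0 : 0 < s + t by rewrite addr_gt0.
rewrite /gauss mulrACA [RHS]mulrACA; congr (_ * _).
  rewrite -!invfM -!sqrtrM ?mulr_ge0 ?pi_ge0 ?ltW//.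
  by congr (Num.sqrt _)^-1; field; rewrite gt_eqF.
rewrite -!expRD; congr expR.
field; rewrite !gt_eqF//=.
Qed.

Lemma gauss_convolution s t a c : 0 < s -> 0 < t ->
  (\int[leb]_z (gauss s (a - z) * gauss t (z - c))%:E =
   (gauss (s + t) (a - c))%:E)%E.
Proof.
move=> s0 t0; under eq_integral do rewrite gauss_mul// EFinM.
rewrite ge0_integralZl//.
- by rewrite integral_gauss ?mule1// divr_gt0 ?mulr_gt0 ?addr_gt0.
- by apply: mgauss; exact: measurable_funB.
- by move=> x _; rewrite lee_fin gauss_ge0.
- by rewrite lee_fin gauss_ge0.
Qed.

(** For a Dirichlet coordinate this is the method of images. The image formula is negative when the
    arguments have opposite signs, whence the cut to the open half-line. *)
Definition line_kernel (b : bool) (t a c : R) : R :=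
  if b then
    if (0 < a) && (0 < c) then gauss t (a - c) - gauss t (a + c) else 0
  else gauss t (a - c).

Lemma gauss_reflected_ge0 t a c : 0 <= a -> 0 <= c ->
  0 <= gauss t (a - c) - gauss t (a + c).
Proof.
move=> a0 c0; rewrite subr_ge0; apply: ler_gauss.
by rewrite [leRHS]ger0_norm ?addr_ge0// ler_norml; apply/andP; split; lra.
Qed.

Lemma line_kernel_ge0 b t a c : 0 <= line_kernel b t a c.
Proof.
rewrite /line_kernel; case: b; last exact: gauss_ge0.
case: ifP => // /andP[a0 c0].
by rewrite gauss_reflected_ge0// ltW.
Qed.

Lemma line_kernel_le_gauss b t a c : line_kernel b t a c <= gauss t (a - c).
Proof.
rewrite /line_kernel; case: b => //; case: ifP => _; last exact: gauss_ge0.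
by rewrite gerBl gauss_ge0.
Qed.

Lemma line_kernel_gt0 b t a c : 0 < t -> (b -> 0 < a) -> (b -> 0 < c) ->
  0 < line_kernel b t a c.
Proof.
rewrite /line_kernel; case: b => t0 a0 c0; last exact: gauss_gt0.
have {}a0 := a0 isT; have {}c0 := c0 isT.
rewrite a0 c0/= subr_gt0; apply: ltr_gauss => //.
by rewrite [ltRHS]gtr0_norm ?addr_gt0// ltr_norml; apply/andP; split; lra.
Qed.

Lemma measurable_line_kernel b d' (T : measurableType d') (tau xi eta : T -> R) :
  measurable_fun setT tau -> measurable_fun setT xi ->
  measurable_fun setT eta ->
  measurable_fun setT (fun w => line_kernel b (tau w) (xi w) (eta w)).
Proof.
move=> mtau mxi meta; rewrite /line_kernel; case: b; last first.
  by apply: measurable_gauss => //; exact: measurable_funB.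
apply: measurable_fun_if => //.
- by apply: measurable_and; exact: measurable_fun_ltr.
- by apply/measurable_funTS/measurable_funB; apply: measurable_gauss => //;
    [exact: measurable_funB|exact: measurable_funD].
Qed.

Let mline_kernel b t a :
  measurable_fun setT (fun c => (line_kernel b t a c)%:E).
Proof. by apply/measurable_EFinP; exact: measurable_line_kernel. Qed.

Lemma integral_line_kernel_le1 b t a : 0 < t ->
  (\int[leb]_c (line_kernel b t a c)%:E <= 1)%E.
Proof.
move=> t0; rewrite -(integral_gauss a t0).
apply: ge0_le_integral => //.
- by move=> x _; rewrite lee_fin line_kernel_ge0.
- exact: mline_kernel.
- by apply: mgauss; exact: measurable_funB.
- by move=> x _; rewrite lee_fin line_kernel_le_gauss.
Qed.

(* The integrand on the half-line extends to an even function, so its integral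
   is half that over the whole line, where gauss_convolution applies. *)
Lemma line_kernel_half_line s t a c : 0 < s -> 0 < t -> 0 < a -> 0 < c ->
  (\int[leb]_z (line_kernel true s a z * line_kernel true t z c)%:E =
   (line_kernel true (s + t) a c)%:E)%E.
Proof.
move=> s0 t0 a0 c0.
pose P (z : R) := line_kernel true s a z * line_kernel true t z c.
set I := (X in X = _); pose G (z : R) := (gauss s (a - z) - gauss s (a + z)) *
  (gauss t (z - c) - gauss t (z + c)).
pose Q1 (z : R) := gauss s (a - z) * gauss t (z - - c).
pose Q2 (z : R) := gauss s (- a - z) * gauss t (z - c).
pose Q3 (z : R) := gauss s (a - z) * gauss t (z - c).
pose Q4 (z : R) := gauss s (- a - z) * gauss t (z - - c).
have gs (z : R) : gauss s (- a - z) = gauss s (a + z) by rewrite -opprD gaussN.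
(* Expanding [G] gives [Q3 + Q4 - Q1 - Q2]; the negative terms are moved to the left so that
   additivity of the integral is used for nonnegative functions only. *)
have PQ z : P z + P (-1 * z) + Q1 z + Q2 z = Q3 z + Q4 z.
  have -> : P z + P (-1 * z) = G z.
    rewrite /P /G /line_kernel a0 c0/= !andbT mulN1r oppr_gt0.
    have gN y : gauss t (- y - c) = gauss t (y + c) by rewrite -opprD gaussN.
    have gN' y : gauss t (- y + c) = gauss t (y - c).
      by rewrite -gaussN opprD opprK.
    rewrite opprK gN gN'.
    have [z0|z0|<-] := ltgtP 0 z; rewrite ?mulr0 ?addr0 ?add0r//; first by ring.
    by rewrite subr0 ?addr0 subrr mul0r.
  by rewrite /G /Q1 /Q2 /Q3 /Q4 !gs !opprK; ring.
have mQ (b d : R) : measurable_fun setT (fun z : R => (gauss s (b - z) * gauss t (z - d))%:E).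
  apply/measurable_EFinP/measurable_funM; apply: measurable_gauss => //;
  exact: measurable_funB.
have Q0 (b d z : R) : (0 <= (gauss s (b - z) * gauss t (z - d))%:E)%E.
  by rewrite lee_fin mulr_ge0// gauss_ge0.
have mP k : measurable_fun setT (fun z : R => (P (k * z))%:E).
  have mk : measurable_fun setT (fun z : R => k * z).
    exact: measurable_funM.
  apply/measurable_EFinP/measurable_funM; exact: measurable_line_kernel.
have mP1 : measurable_fun setT (fun z : R => (P z)%:E).
  by have := mP 1; under eq_fun do rewrite mul1r.
have P0 z : (0 <= (P z)%:E)%E.
  by rewrite lee_fin mulr_ge0// line_kernel_ge0.
have IP : (\int[leb]_z (P (-1 * z))%:E = \int[leb]_z (P z)%:E)%E.
  rewrite (@ge0_integral_scale_line (-1) (fun z : R => (P z)%:E))//.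
  by rewrite normrN1 invr1 mul1e.
have ID (f g : R -> R) : measurable_fun setT (EFin \o f) ->
    measurable_fun setT (EFin \o g) ->
    (forall z, 0 <= (f z)%:E)%E -> (forall z, 0 <= (g z)%:E)%E ->
    (\int[leb]_z (f z + g z)%:E =
     \int[leb]_z (f z)%:E + \int[leb]_z (g z)%:E)%E.
  move=> mf mg f0 g0; under eq_integral do rewrite EFinD.
  exact: ge0_integralD.
have : (\int[leb]_z (P z + P (-1 * z) + Q1 z + Q2 z)%:E =
   \int[leb]_z (Q3 z + Q4 z)%:E)%E.
  by apply: eq_integral => z _; rewrite PQ.
have mPP : measurable_fun setT (fun z : R => (P z + P (-1 * z))%:E).
  exact: (emeasurable_funD mP1 (mP (-1))).
have PP0 z : (0 <= (P z + P (-1 * z))%:E)%E.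
  by rewrite EFinD; apply: adde_ge0; exact: P0.
have PPQ0 z : (0 <= (P z + P (-1 * z) + Q1 z)%:E)%E.
  by rewrite EFinD; apply: adde_ge0; [exact: PP0|exact: Q0].
rewrite (ID _ _ (emeasurable_funD mPP (mQ a (- c))) (mQ (- a) c) PPQ0 (Q0 _ _)).
rewrite (ID _ _ mPP (mQ a (- c)) PP0 (Q0 _ _)).
rewrite (ID _ _ mP1 (mP (-1)) P0 (fun z => P0 _)).
rewrite (ID _ _ (mQ a c) (mQ (- a) (- c)) (Q0 _ _) (Q0 _ _)).
have -> := gauss_convolution a (- c) s0 t0.
have -> := gauss_convolution (- a) c s0 t0.
have -> := gauss_convolution a c s0 t0.
have -> := gauss_convolution (- a) (- c) s0 t0.
have -> : gauss (s + t) (- a - c) = gauss (s + t) (a + c).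
  by rewrite -opprD gaussN.
have -> : gauss (s + t) (- a - - c) = gauss (s + t) (a - c).
  by rewrite -opprD gaussN.
rewrite opprK IP -/I.
(* The identity now reads I + I + 2 g(a + c) = 2 g(a - c) with g = [gauss (s + t)]; it forces [I] to
   be finite and can then be solved for it. *)
have : (0 <= I)%E by apply: integral_ge0 => x _; exact: P0.
clearbody I; case: I => [r _ [] e|_|//]; last by [].
rewrite /line_kernel a0 c0/=; congr EFin; lra.
Qed.

Lemma line_kernel_semigroup b s t a c : 0 < s -> 0 < t ->
  (\int[leb]_z (line_kernel b s a z * line_kernel b t z c)%:E =
   (line_kernel b (s + t) a c)%:E)%E.
Proof.
move=> s0 t0; case: b; last exact: gauss_convolution.
have [a0|a0] := ltP 0 a; last first.
  rewrite {3}/line_kernel ltNge a0/= integral0_eq// => x _.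
  by rewrite /line_kernel [0 < a]ltNge a0/= mul0r.
have [c0|c0] := ltP 0 c; first exact: line_kernel_half_line.
rewrite {3}/line_kernel [0 < c]ltNge c0/= andbF integral0_eq// => x _.
by rewrite /line_kernel [0 < c]ltNge c0/= andbF mulr0.
Qed.
End line.

(** * Lebesgue integration on row vectors *)

Section row_vectors.
Context {R : realType}.

Local Notation leb := (@lebesgue_measure R).
Local Notation mu n := (@lebesgue_rV R n).

Lemma ge0_integral_rVS n (f : 'rV[R]_n.+1 -> \bar R) :
  measurable_fun setT f -> (forall x, 0 <= f x)%E ->
  (\int[mu n.+1]_x f x = \int[leb]_a \int[mu n]_v f (rV_cons (a, v)))%E.
Proof.
move=> mf f0.
transitivity (\int[(leb \x mu n)%E]_p (f \o @rV_cons R n) p)%E.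
  have := @ge0_integral_pushforward _ _ (measurableTypeR R * 'rV[R]_n)%type
    'rV[R]_n.+1 R _ (@measurable_rV_cons R n) (leb \x mu n)%E setT f
    measurableT mf (fun x _ => f0 x).
  by rewrite preimage_setT.
rewrite fubini_tonelli1//; last by move=> x; exact: f0.
by apply: measurableT_comp => //; exact: measurable_rV_cons.
Qed.

Lemma ge0_integral_rV0 (f : 'rV[R]_0 -> \bar R) :
  measurable_fun setT f -> (\int[mu 0]_x f x = f 0%R)%E.
Proof. by move=> mf; rewrite /= integral_dirac// diracT mul1e. Qed.

Lemma measurable_fun_integral_rV_cons n (f : 'rV[R]_n.+1 -> \bar R) :
  measurable_fun setT f -> (forall x, 0 <= f x)%E ->
  measurable_fun setT (fun a => \int[mu n]_v f (rV_cons (a, v)))%E.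
Proof.
move=> mf f0.
apply: (measurable_fun_fubini_tonelli_F (fun p => f (rV_cons p))) => //.
by apply: measurableT_comp => //; exact: measurable_rV_cons.
Qed.

Lemma rV_cons_head n a (v : 'rV[R]_n) : rV_cons (a, v) ord0 ord0 = a.
Proof. by rewrite mxE unlift_none. Qed.

Lemma rV_cons_lift n a (v : 'rV[R]_n) i :
  rV_cons (a, v) ord0 (lift ord0 i) = v ord0 i.
Proof. by rewrite mxE liftK. Qed.

Lemma measurable_rV_prod n (f : 'I_n -> R -> R) :
  (forall i, measurable_fun setT (f i)) ->
  measurable_fun setT (fun x : 'rV[R]_n => \prod_(i < n) f i (x ord0 i)).
Proof.
move=> mf; apply: measurable_prod => i _.
by apply: (measurableT_comp (mf i)); exact: measurable_coord.
Qed.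

Lemma integral_rV_prod n (f : 'I_n -> R -> R) :
  (forall i, measurable_fun setT (f i)) -> (forall i a, 0 <= f i a) ->
  (\int[mu n]_x (\prod_(i < n) f i (x ord0 i))%:E =
   \prod_(i < n) \int[leb]_a (f i a)%:E)%E.
Proof.
elim: n f => [|n IH] f mf f0.
  rewrite ge0_integral_rV0 ?big_ord0//.
  by apply/measurable_EFinP; exact: measurable_rV_prod.
rewrite ge0_integral_rVS//; last 2 first.
- by apply/measurable_EFinP; exact: measurable_rV_prod.
- by move=> x; rewrite lee_fin prodr_ge0.
rewrite [in RHS]big_ord_recl -IH//.
rewrite -ge0_integralZr//; last 3 first.
- by apply/measurable_EFinP; exact: mf.
- by move=> x _; rewrite lee_fin.
- by apply: integral_ge0 => x _; rewrite lee_fin prodr_ge0.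
apply: eq_integral => a _.
rewrite -ge0_integralZl//; last 3 first.
- by apply/measurable_EFinP; apply: (measurable_rV_prod (fun i => mf (lift ord0 i))).
- by move=> x _; rewrite lee_fin prodr_ge0.
- by rewrite lee_fin.
apply: eq_integral => v _.
rewrite big_ord_recl rV_cons_head EFinM; congr (_ * (_)%:E)%E.
by apply: eq_bigr => i _; rewrite rV_cons_lift.
Qed.

(** Dilations are the case of constant [d], reflections that of one entry -1 and the others 1; both
    share one change of variables. *)
Definition rV_scale n (d : 'I_n -> R) (x : 'rV[R]_n) : 'rV[R]_n :=
  \row_i (d i * x ord0 i).

Lemma measurable_rV_scale n (d : 'I_n -> R) :
  measurable_fun setT (rV_scale d).
Proof.
apply: measurable_fun_rV => i.
under eq_fun do rewrite mxE.
by apply: measurable_funM => //; exact: measurable_coord.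
Qed.

Lemma rV_scale_cons n (d : 'I_n.+1 -> R) a (v : 'rV[R]_n) :
  rV_scale d (rV_cons (a, v)) =
  rV_cons (d ord0 * a, rV_scale (fun i => d (lift ord0 i)) v).
Proof.
apply/rowP => i; rewrite mxE.
have [j ->|->] := unliftP ord0 i; first by rewrite !rV_cons_lift mxE.
by rewrite !rV_cons_head.
Qed.

Lemma ge0_integral_rV_scale n (d : 'I_n -> R) (f : 'rV[R]_n -> \bar R) :
  (forall i, d i != 0) -> measurable_fun setT f -> (forall x, 0 <= f x)%E ->
  (\int[mu n]_x f (rV_scale d x) =
   ((\prod_(i < n) `|d i|)^-1)%:E * \int[mu n]_x f x)%E.
Proof.
elim: n d f => [|n IH] d f d0 mf f0.
  rewrite !ge0_integral_rV0 ?big_ord0 ?invr1 ?mul1e//.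
    by congr f; apply/rowP => -[].
  by apply: measurableT_comp => //; exact: measurable_rV_scale.
rewrite !ge0_integral_rVS//; last first.
  by apply: measurableT_comp => //; exact: measurable_rV_scale.
pose F a := (\int[mu n]_v f (rV_cons (a, v)))%E.
have F0 a : (0 <= F a)%E by apply: integral_ge0 => v _; exact: f0.
have mF : measurable_fun setT F by exact: measurable_fun_integral_rV_cons.
transitivity (\int[leb]_a
  (((\prod_(i < n) `|d (lift ord0 i)|)^-1)%:E * F (d ord0 * a)%R))%E.
  apply: eq_integral => a _; under eq_integral do rewrite rV_scale_cons.
  rewrite (IH _ (fun v => f (rV_cons (d ord0 * a, v))))//.
  apply: measurableT_comp => //.
  by apply: measurableT_comp; [exact: measurable_rV_cons|exact: pair1_measurable].
have P0 : 0 <= (\prod_(i < n) `|d (lift ord0 i)|)^-1.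
  by rewrite invr_ge0 prodr_ge0.
rewrite ge0_integralZl//; last first.
  by apply: (measurableT_comp mF); exact: measurable_funM.
rewrite (ge0_integral_scale_line (d0 ord0) mF F0).
by rewrite muleA -EFinM big_ord_recl invfM mulrC.
Qed.

End row_vectors.

(** * Functions continuous in one variable and measurable in the other *)

Section separately_continuous.
Context {R : realType}.

Let grid n (s : R) : R := (Num.floor (s * n.+1%:R))%:~R / n.+1%:R.

Let grid_cvg s : (grid ^~ s) @ \oo --> s.
Proof.
apply/cvgrPdist_le => e e0; near=> n.
have n0 : (0 : R) < n.+1%:R by rewrite ltr0n.
rewrite /grid -[X in X - _](mulfK (lt0r_neq0 n0)) -mulrBl normrM.
rewrite [X in _ * X]gtr0_norm ?invr_gt0// ler_pdivrMr//.
have /andP[fl fr] := floor_itv (s * n.+1%:R).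
rewrite ger0_norm ?subr_ge0//.
apply: (@le_trans _ _ 1); first by rewrite lerBlDl -intrD1 ltW.
have /ltW ne : n.+1%:R^-1 < e.
  by near: n; exact: near_infty_natSinv_lt (PosNum e0).
by rewrite -[leLHS](mulVf (lt0r_neq0 n0)) ler_pM2r.
Unshelve. all: by end_near. Qed.

(** Rounding the first variable down to multiples of 1/(n+1) gives functions that are measurable on
    each of countably many strips; continuity in the first variable makes them converge pointwise on
    [D]. *)
Lemma measurable_fun_separately d (T : measurableType d) (f : R -> T -> R)
    (D : set R) : measurable D ->
  (forall s, measurable_fun setT (f s)) ->
  (forall s y, D s -> f^~ y x @[x --> s] --> f s y) ->
  measurable_fun (D `*` setT) (fun p : R * T => f p.1 p.2).
Proof.
move=> mD mf cf.
apply: (@measurable_fun_cvg _ (R * T)%type R (D `*` setT)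
  (fun n p => f (grid n p.1) p.2)); last first.
  move=> [s y] [/= Ds _]; have := cf _ y Ds.
  by apply: cvg_comp; exact: grid_cvg.
move=> n; apply: measurable_funTS => _ B mB; rewrite setTI.
rewrite (_ : _ @^-1` _ = \bigcup_(k : int)
    ([set s : R | Num.floor (s * n.+1%:R) = k] `*`
     (f (k%:~R / n.+1%:R) @^-1` B))); last first.
  apply/seteqP; split=> [[s y] /= Bs|[s y] [k _ [/= sk By]]].
    by exists (Num.floor (s * n.+1%:R)).
  by rewrite /grid sk.
apply: countable_bigcupT_measurable => // k; apply: measurableX; last first.
  by rewrite -[X in measurable X]setTI; exact: mf.
have n0 : (0 : R) < n.+1%:R by rewrite ltr0n.
rewrite (_ : mkset _ = `[k%:~R / n.+1%:R, (k + 1)%:~R / n.+1%:R[%classic)//.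
apply/seteqP; split => s /=; rewrite in_itv/= ler_pdivrMr// ltr_pdivlMr//.
  by move=> <-; exact: floor_itv.
exact: floor_def.
Qed.

Lemma continuous_rV_cons_tail n (a : R) :
  continuous (fun v : 'rV[R]_n => rV_cons (a, v)).
Proof.
move=> /= v A /= /(nbhs_ballP (rV_cons (a, v))) [e e0 eA].
apply/nbhs_ballP; exists e => //= w [_ vw]; apply: eA; split=> // i j; rewrite (ord1 i).
have [k ->|->] := unliftP ord0 j; first by rewrite !rV_cons_lift.
by rewrite !rV_cons_head; exact: ballxx.
Qed.

Lemma continuous_rV_cons_head n (v : 'rV[R]_n) :
  continuous (fun a : R => rV_cons (a, v)).
Proof.
move=> /= a A /= /(nbhs_ballP (rV_cons (a, v))) [e e0 eA].
apply/nbhs_ballP; exists e => //= c ac; apply: eA; split=> // i j; rewrite (ord1 i).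
have [k ->|->] := unliftP ord0 j; last by rewrite !rV_cons_head.
by rewrite !rV_cons_lift; exact: ballxx.
Qed.

Lemma rV_cons_eta n (x : 'rV[R]_n.+1) : rV_cons (x ord0 ord0, rV_behead x) = x.
Proof.
apply/rowP => i; have [j ->|->] := unliftP ord0 i.
  by rewrite rV_cons_lift mxE.
by rewrite rV_cons_head.
Qed.

(** The sigma-algebra on row vectors is generated by the coordinates rather than by the open sets,
    hence the induction that splits off one coordinate at a time. *)
Lemma continuous_measurable_rV n (f : 'rV[R]_n -> R) :
  continuous f -> measurable_fun setT f.
Proof.
elim: n f => [f _|n IH f cf].
  rewrite (_ : f = cst (f 0))//; apply/funext => x.
  by congr f; apply/rowP => -[].
rewrite (_ : f = (fun p : R * 'rV[R]_n => f (rV_cons (p.1, p.2))) \o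
    (fun x : 'rV[R]_n.+1 => (x ord0 ord0, rV_behead x))); last first.
  by apply/funext => x /=; rewrite rV_cons_eta.
apply: measurableT_comp; last first.
  by apply: measurable_fun_pair;
    [exact: measurable_coord|exact: measurable_rV_behead].
have := @measurable_fun_separately _ _ (fun a v => f (rV_cons (a, v))) setT
  measurableT.
rewrite setXTT; apply.
  move=> a; apply: IH => v.
  by apply: continuous_comp; [exact: continuous_rV_cons_tail|exact: cf].
move=> a v _.
by apply: (continuous_comp (@continuous_rV_cons_head _ v a)); exact: cf.
Qed.

End separately_continuous.

(** * The Dirichlet heat kernel of Omega m *)

Section dirichlet_kernel.
Context {R : realType} (N m : nat).
Implicit Types (s t r : R) (x y z : 'rV[R]_N) (f : 'rV[R]_N -> R).

Local Notation mu := (@lebesgue_rV R N).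
Local Notation Om := (@Omega R N m).

(* Unlike heat_kernel, it vanishes as soon as one of its arguments leaves
   Omega m, hence it is nonnegative everywhere. *)
Definition dirichlet_kernel t x y : R :=
  \prod_(i < N) line_kernel (i < m)%N t (x ord0 i) (y ord0 i).

Lemma dirichlet_kernel_ge0 t x y : 0 <= dirichlet_kernel t x y.
Proof. by apply: prodr_ge0 => i _; exact: line_kernel_ge0. Qed.

Lemma dirichlet_kernel_gt0 t x y : 0 < t -> Om x -> Om y ->
  0 < dirichlet_kernel t x y.
Proof.
move=> t0 Ox Oy; apply: prodr_gt0 => i _.
by apply: line_kernel_gt0 => // im; [exact: Ox|exact: Oy].
Qed.

Lemma dirichlet_kernelE t x y : Om x -> Om y ->
  dirichlet_kernel t x y = heat_kernel m t x y.
Proof.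
move=> Ox Oy; apply: eq_bigr => i _; rewrite /line_kernel.
by case: ifPn => // im; rewrite Ox// Oy.
Qed.

Lemma dirichlet_kernel_out t x y : ~ Om y -> dirichlet_kernel t x y = 0.
Proof.
move=> /existsNP[i /not_implyP[im /negP]]; rewrite -leNgt => yi.
rewrite /dirichlet_kernel (bigD1 i)//= /line_kernel im ltNge [0 < y ord0 i]ltNge.
by rewrite yi andbF mul0r.
Qed.

Lemma heat_semigroupE t f x : Om x ->
  (heat_semigroup m t f x = \int[mu]_y (dirichlet_kernel t x y * f y)%:E)%E.
Proof.
move=> Ox; rewrite /heat_semigroup integral_mkcond; apply: eq_integral => y _.
rewrite patchE; case: ifPn; rewrite (inE, notin_setE) => Oy.
  by rewrite dirichlet_kernelE.
by rewrite dirichlet_kernel_out// mul0r.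
Qed.

Lemma measurable_dirichlet_kernel d (T : measurableType d) (tau : T -> R)
    (xi eta : T -> 'rV[R]_N) :
  measurable_fun setT tau -> measurable_fun setT xi ->
  measurable_fun setT eta ->
  measurable_fun setT (fun w => dirichlet_kernel (tau w) (xi w) (eta w)).
Proof.
move=> mtau mxi meta; apply: measurable_prod => i _.
have mcoord (g : T -> 'rV[R]_N) : measurable_fun setT g ->
    measurable_fun setT (fun w => g w ord0 i).
  by move=> mg; apply: (measurableT_comp (measurable_coord i)).
by apply: measurable_line_kernel => //; exact: mcoord.
Qed.

Lemma integral_dirichlet_kernel_le1 t x : 0 < t ->
  (\int[mu]_y (dirichlet_kernel t x y)%:E <= 1)%E.
Proof.
move=> t0; rewrite (integral_rV_prod (f := fun i a =>
  line_kernel (i < m)%N t (x ord0 i) a)); last 2 first.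
- by move=> i; exact: measurable_line_kernel.
- by move=> i a; exact: line_kernel_ge0.
(* A bound by 1 passes to products only together with nonnegativity, so the induction carries
   both. *)
suff /andP[] : (0 <= \prod_(i < N)
  \int[lebesgue_measure]_a (line_kernel (i < m)%N t (x ord0 i) a)%:E <= 1)%E by [].
elim/big_ind: _ => [|a b /andP[a0 a1] /andP[b0 b1]|i _].
- by rewrite lee01 lexx.
- by rewrite mule_ge0//= (le_trans (lee_wpmul2r b0 a1))// mul1e.
- rewrite integral_line_kernel_le1// andbT.
  by apply: integral_ge0 => a _; rewrite lee_fin line_kernel_ge0.
Qed.

Lemma dirichlet_kernel_semigroup s t x y : 0 < s -> 0 < t ->
  (\int[mu]_z (dirichlet_kernel s x z * dirichlet_kernel t z y)%:E =
   (dirichlet_kernel (s + t) x y)%:E)%E.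
Proof.
move=> s0 t0; under eq_integral do rewrite -big_split/=.
rewrite (integral_rV_prod (f := fun i a => line_kernel (i < m)%N s (x ord0 i) a *
  line_kernel (i < m)%N t a (y ord0 i))); last 2 first.
- by move=> i; apply: measurable_funM; exact: measurable_line_kernel.
- by move=> i a; rewrite mulr_ge0// line_kernel_ge0.
rewrite -prodEFin; apply: eq_bigr => i _.
by rewrite line_kernel_semigroup.
Qed.

Lemma gauss_scale r (a : R) : 0 < r ->
  gauss (r ^+ 2) (r * a) = r^-1 * gauss 1 a.
Proof.
move=> r0; rewrite /gauss mulr1 sqrtrM ?mulr_ge0 ?pi_ge0// sqrtr_sqr gtr0_norm//.
rewrite invfM [_^-1 * _]mulrC -mulrA; congr (_ * (_ * expR _)).
by rewrite exprMn; field; rewrite gt_eqF.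
Qed.

Lemma line_kernel_scale b r (a c : R) : 0 < r ->
  line_kernel b (r ^+ 2) (r * a) (r * c) = r^-1 * line_kernel b 1 a c.
Proof.
move=> r0; rewrite /line_kernel !pmulr_rgt0// -(mulrBr r) -(mulrDr r) !gauss_scale//.
by case: b => //; case: ifP => _; rewrite ?mulr0// mulrBr.
Qed.

Lemma dirichlet_kernel_scale r x z : 0 < r ->
  dirichlet_kernel (r ^+ 2) (r *: x) (r *: z) =
  r ^- N * dirichlet_kernel 1 x z.
Proof.
move=> r0; rewrite /dirichlet_kernel.
under eq_bigr do rewrite !mxE line_kernel_scale//.
by rewrite big_split/= prodr_const card_ord exprVn.
Qed.

End dirichlet_kernel.

(** * Power growth *)

Section power_inequalities.
Context {R : realType}.
Implicit Types (alpha x u c : R).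

(** The tangent at [c] to the convex function u^(1+alpha). With u = c e^l it reduces to e^(alpha l)
    + alpha e^(-l) >= 1 + alpha, a combination of two instances of e^x >= 1 + x. *)
Lemma powR_tangent alpha u c : 0 < alpha -> 0 <= u -> 0 < c ->
  (1 + alpha) * c `^ alpha * u <= u `^ alpha * u + alpha * (c `^ alpha * c).
Proof.
move=> a0; rewrite le_eqVlt => /predU1P[<- c0|u0 c0].
  by rewrite !mulr0 add0r !mulr_ge0 ?powR_ge0// ltW.
pose l := ln (u / c).
have uc : u = expR l * c by rewrite lnK ?divfK ?gt_eqF// posrE divr_gt0.
have -> : u `^ alpha = expR (alpha * l) * c `^ alpha.
  by rewrite uc powRM ?expR_ge0 ?ltW// [alpha * l]mulrC expRM.
have e1 := expR_ge1Dx (alpha * l).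
have e2 := expR_ge1Dx (- l).
have e3 : expR (- l) * expR l = 1 by rewrite -expRD addNr expR0.
have p0 : 0 < c `^ alpha * (expR l * c) by rewrite !mulr_gt0 ?powR_gt0 ?expR_gt0.
have -> : alpha * (c `^ alpha * c) =
  alpha * expR (- l) * (c `^ alpha * (expR l * c)).
  by rewrite -[LHS]mulr1 -e3; ring.
rewrite uc -subr_ge0; set C := c `^ alpha in p0 *.
have -> : expR (alpha * l) * C * (expR l * c) + alpha * expR (- l) * (C * (expR l * c)) -
    (1 + alpha) * C * (expR l * c) =
  (expR (alpha * l) + alpha * expR (- l) - (1 + alpha)) * (C * (expR l * c)).
  by ring.
apply: mulr_ge0; last exact: ltW.
have := ler_wpM2l (ltW a0) e2; lra.
Qed.

(** The first-order decrease of (1 + x)^(-alpha) with an explicit quadratic error: over n steps of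
    size O(1/n) the errors add up to O(1/n). *)
Lemma powRN_1Dx_le alpha x : 0 < alpha -> 0 <= x ->
  (1 + x) `^ (- alpha) <= 1 - alpha * x * (1 - (1 + alpha) * x).
Proof.
move=> a0 x0; have y0 : 0 < 1 + x by rewrite ltr_pwDl.
pose l := ln (1 + x).
have yl : 1 + x = expR l by rewrite lnK.
have lx : l <= x by apply: le_ln1Dx; rewrite (lt_le_trans _ x0)// ltrN10.
have l0 : 0 <= l by rewrite ln_ge0// lerDl.
have -> : (1 + x) `^ (- alpha) = expR (- (alpha * l)).
  by rewrite yl -expRM mulrN mulrC.
set E := expR (- (alpha * l)); have E0 : 0 < E := expR_gt0 _.
have EE : E * expR (alpha * l) = 1 by rewrite -expRD addNr expR0.
have F1 := expR_ge1Dx (alpha * l).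
have LL : x * expR (- l) = 1 - expR (- l).
  have := expRD l (- l); rewrite subrr expR0 -yl; lra.
have F2 := expR_ge1Dx (- l).
have F3 := expR_ge1Dx (- ((1 + alpha) * l)).
have -> : 1 = E * expR (alpha * l) :> R by rewrite EE.
have E3 : E * expR (- l) = expR (- ((1 + alpha) * l)).
  by rewrite /E -expRD; congr expR; ring.
(* The three bounds chain to 1 - E >= alpha l E >= alpha x e^(-(1+alpha) l) >= alpha x (1 -
   (1+alpha) x). *)
have h1 : alpha * l * E <= 1 - E by rewrite -EE; nra.
have h2 : x * expR (- ((1 + alpha) * l)) <= l * E by rewrite -E3; nra.
have h3 : x * (1 - (1 + alpha) * x) <= x * expR (- ((1 + alpha) * l)).
  by apply: ler_wpM2l => //; nra.
rewrite EE; nra.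
Qed.

Lemma powR_mul_le alpha u c : 0 < alpha -> 0 <= u -> u <= c ->
  u `^ alpha * u <= c `^ alpha * c.
Proof.
move=> a0 u0 uc; apply: ler_pM => //; first exact: powR_ge0.
by apply: (ge0_ler_powR (ltW a0)); rewrite ?nnegrE// (le_trans u0).
Qed.

End power_inequalities.

Section blow_up.
Context {R : realType}.

(* Discrete version of the comparison with h' = h^(1+alpha), which requires no
   regularity of H: along a subdivision of step d, (H (k d))^(-alpha)
   decreases by at least alpha d (1 - O(d)) at each step. *)
Lemma powR_growth_time (alpha A S : R) (H : R -> R) : 0 < alpha -> 0 < A ->
  0 <= S -> A <= H 0 ->
  (forall a b, 0 <= a -> a <= b -> b <= S ->
    H a + (b - a) * (H a `^ alpha * H a) <= H b) ->
  alpha * S * A `^ alpha <= 1.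
Proof.
move=> a0 A0 S0 AH H1.
have HA a : 0 <= a -> a <= S -> A <= H a.
  move=> a0' aS; apply: (le_trans AH); apply: le_trans (H1 _ _ (lexx 0) a0' aS).
  by rewrite lerDl subr0 !mulr_ge0 ?powR_ge0// (le_trans _ AH)// ltW.
(* The hypothesis makes [H] nondecreasing on [0, S], so [M] controls the error uniformly over all
   steps. *)
pose M := H S `^ alpha.
have HM a : 0 <= a -> a <= S -> H a `^ alpha <= M.
  move=> a0' aS; have Ha := lt_le_trans A0 (HA _ a0' aS).
  apply: ge0_ler_powR; rewrite ?nnegrE ?(ltW a0)// ?(ltW Ha)//.
    by rewrite (le_trans (ltW A0))// HA.
  apply: le_trans (H1 _ _ a0' aS (lexx S)).
  by rewrite lerDl !mulr_ge0 ?powR_ge0 ?subr_ge0// ltW.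
have step (a b : R) : 0 <= a -> a <= b -> b <= S -> H b `^ (- alpha) <=
    H a `^ (- alpha) - alpha * (b - a) * (1 - (1 + alpha) * ((b - a) * M)).
  move=> a0' ab bS; have aS := le_trans ab bS.
  have Ha := lt_le_trans A0 (HA _ a0' aS).
  have p0 : 0 < H a `^ alpha by exact: powR_gt0.
  set d := b - a; have d0 : 0 <= d by rewrite subr_ge0.
  (* Since [x] carries the factor H(a)^alpha, multiplying the first-order decrease [alpha * x] by
     H(a)^(-alpha) leaves [alpha * d], free of [H]. *)
  pose x := d * H a `^ alpha; have x0 : 0 <= x by rewrite mulr_ge0// ltW.
  have Hb : H a * (1 + x) <= H b.
    by apply: le_trans (H1 _ _ a0' ab bS); rewrite le_eqVlt -/d /x; apply/orP; left;
      apply/eqP; ring.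
  have Hax : 0 < H a * (1 + x) by rewrite mulr_gt0// ltr_pwDl.
  apply: (@le_trans _ _ (H a `^ (- alpha) * (1 + x) `^ (- alpha))).
    rewrite -powRM ?(ltW Ha) ?addr_ge0// !powRN lef_pV2 ?posrE ?powR_gt0//.
      by apply: ge0_ler_powR; rewrite ?nnegrE ?(ltW a0) ?(ltW Hax)//
        (le_trans (ltW Hax)).
    exact: lt_le_trans Hb.
  apply: (le_trans (ler_wpM2l (powR_ge0 _ _) (powRN_1Dx_le a0 x0))).
  rewrite powRN; set P := (_ `^ alpha)^-1.
  have PP : P * H a `^ alpha = 1 by rewrite mulVf// gt_eqF.
  have -> : P * (1 - alpha * x * (1 - (1 + alpha) * x)) =
    P - alpha * d * (1 - (1 + alpha) * x) * (P * H a `^ alpha).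
    by rewrite /x; ring.
  rewrite PP mulr1 lerB// ler_wpM2l ?mulr_ge0 ?(ltW a0)// lerB//.
  by rewrite ler_wpM2l ?addr_ge0 ?(ltW a0)// ler_wpM2l// HM.
(* After [n] equal steps the quantity H^(-alpha), still nonnegative, has lost the left-hand side
   from a starting value of at most A^(-alpha). *)
have sum n : (0 < n)%N ->
    alpha * S * (1 - (1 + alpha) * (S / n%:R * M)) <= A `^ (- alpha).
  move=> n0; have n0' : 0 < n%:R :> R by rewrite ltr0n.
  pose d := S / n%:R; have d0 : 0 <= d by rewrite divr_ge0.
  have ind k : (k <= n)%N -> H (k%:R * d) `^ (- alpha) <= A `^ (- alpha) -
      k%:R * (alpha * d * (1 - (1 + alpha) * (d * M))).
    elim: k => [_|k IH kn].
      rewrite !mul0r subr0 !powRN lef_pV2 ?posrE ?powR_gt0//.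
        apply: ge0_ler_powR => //; rewrite ?nnegrE ?(ltW a0)//.
          exact: ltW.
        exact: (le_trans (ltW A0)).
      exact: lt_le_trans AH.
    have k1 : k.+1%:R * d - k%:R * d = d by rewrite -mulrBl -natrB// subSnn mul1r.
    have := step (k%:R * d) (k.+1%:R * d); rewrite k1.
    have -> : (0 <= k%:R * d)%R by rewrite mulr_ge0.
    rewrite ler_wpM2r// ?ler_nat ?leqnSn//.
    have -> : k.+1%:R * d <= S.
      by rewrite /d mulrCA ler_piMr// ler_pdivrMr// mul1r ler_nat.
    move=> /(_ isT isT isT) /le_trans; apply.
    have := IH (ltnW kn).
    by rewrite -natr1; set X := alpha * d * _; lra.
  have := le_trans (powR_ge0 _ _) (ind n (leqnn n)).
  have nd : n%:R * d = S by rewrite /d mulrCA divff ?mulr1// gt_eqF.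
  rewrite subr_ge0; apply: le_trans; rewrite -/d -{1}nd le_eqVlt.
  by apply/orP; left; apply/eqP; ring.
have aS : alpha * S <= A `^ (- alpha).
  apply/ler_addgt0Pr => e e0.
  (* [K / n] is the accumulated error of [n] steps; [n] is taken large enough to bring it below
     [e]. *)
  pose K := alpha * S * ((1 + alpha) * (S * M)).
  have K0 : 0 <= K.
    by rewrite !mulr_ge0 ?addr_ge0 ?powR_ge0// ltW.
  pose n := (Num.truncn (K / e)).+1.
  have n0 : 0 < n%:R :> R by rewrite ltr0n.
  have Ke : K / n%:R <= e.
    rewrite ler_pdivrMr// mulrC -ler_pdivrMr//.
    by rewrite ltW// truncnS_gt.
  have := sum n isT.
  have -> : alpha * S * (1 - (1 + alpha) * (S / n%:R * M)) =
    alpha * S - K / n%:R by rewrite /K; ring.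
  lra.
have p0 := powR_gt0 alpha A0.
apply: le_trans (ler_wpM2r (ltW p0) aS) _.
by rewrite powRN mulVf// gt_eqF.
Qed.

End blow_up.

(** * Upper bound on S(t) u0 along a solution *)

Section weissler.
Context {R : realType} (N m : nat).
Implicit Types (s t alpha c : R) (x y z : 'rV[R]_N) (f g : 'rV[R]_N -> R).

Local Notation leb := (@lebesgue_measure R).
Local Notation mu := (@lebesgue_rV R N).
Local Notation Om := (@Omega R N m).
Local Notation K := (@dirichlet_kernel R N m).

Definition dirichlet_heat t g x : \bar R := (\int[mu]_y (K t x y * g y)%:E)%E.

Let mK t x : measurable_fun setT (K t x).
Proof. exact: measurable_dirichlet_kernel. Qed.

Let mKg t x g : measurable_fun setT g ->
  measurable_fun setT (fun y => (K t x y * g y)%:E).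
Proof. by move=> mg; apply/measurable_EFinP/measurable_funM. Qed.

Lemma dirichlet_heat_ge0 t g x : (forall y, 0 <= g y) ->
  (0 <= dirichlet_heat t g x)%E.
Proof.
move=> g0; apply: integral_ge0 => y _.
by rewrite lee_fin mulr_ge0// dirichlet_kernel_ge0.
Qed.

Lemma measurable_dirichlet_heat d (T : measurableType d) (tau : T -> R)
    (xi : T -> 'rV[R]_N) (g : T * 'rV[R]_N -> R) :
  measurable_fun setT tau -> measurable_fun setT xi -> measurable_fun setT g ->
  (forall p, 0 <= g p) ->
  measurable_fun setT
    (fun w => dirichlet_heat (tau w) (fun y => g (w, y)) (xi w)).
Proof.
move=> mtau mxi mg g0.
apply: (measurable_fun_fubini_tonelli_F
  (fun p : T * 'rV[R]_N => (K (tau p.1) (xi p.1) p.2 * g p)%:E)) => /=.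
  apply/measurable_EFinP/measurable_funM => //.
  by apply: measurable_dirichlet_kernel => //; exact: measurableT_comp.
by move=> p; rewrite lee_fin mulr_ge0// dirichlet_kernel_ge0.
Qed.

Lemma dirichlet_heat_semigroup s t g x : 0 < s -> 0 < t ->
  measurable_fun setT g -> (forall y, 0 <= g y) ->
  (\int[mu]_z ((K s x z)%:E * dirichlet_heat t g z) =
   dirichlet_heat (s + t) g x)%E.
Proof.
move=> s0 t0 mg g0.
pose F (p : 'rV[R]_N * 'rV[R]_N) := ((K s x p.1)%:E * (K t p.1 p.2 * g p.2)%:E)%E.
have F0 p : (0 <= F p)%E.
  by rewrite /F -EFinM lee_fin !mulr_ge0// dirichlet_kernel_ge0.
have mF : measurable_fun setT F.
  apply: emeasurable_funM; apply/measurable_EFinP.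
    exact: (measurableT_comp (mK s x)).
  apply: measurable_funM; first exact: measurable_dirichlet_kernel.
  exact: (measurableT_comp mg).
transitivity (\int[mu]_z \int[mu]_y F (z, y))%E.
  apply: eq_integral => z _; rewrite -ge0_integralZl//.
  - exact: mKg.
  - by move=> y _; rewrite lee_fin mulr_ge0// dirichlet_kernel_ge0.
  - by rewrite lee_fin dirichlet_kernel_ge0.
rewrite (fubini_tonelli F mF F0); apply: eq_integral => y _.
transitivity (\int[mu]_z ((g y)%:E * (K s x z * K t z y)%:E))%E.
  by apply: eq_integral => z _; rewrite /F -!EFinM /= mulrA mulrC.
rewrite ge0_integralZl//.
- by rewrite dirichlet_kernel_semigroup// -EFinM mulrC.
- apply/measurable_EFinP/measurable_funM => //.
  exact: measurable_dirichlet_kernel.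
- by move=> z _; rewrite lee_fin mulr_ge0// dirichlet_kernel_ge0.
- by rewrite lee_fin.
Qed.

(** The tangent inequality at the mean value [c] itself is integrated against the kernel. Its
    constant term enters with a favourable sign, so total mass at most 1 is enough. *)
Lemma dirichlet_heat_jensen alpha t g x c : 0 < alpha -> 0 < t ->
  measurable_fun setT g -> (forall y, 0 <= g y) ->
  dirichlet_heat t g x = c%:E ->
  ((c `^ alpha * c)%:E <= dirichlet_heat t (fun y => g y `^ alpha * g y)%R x)%E.
Proof.
move=> a0 t0 mg g0 Ec.
have mp : measurable_fun setT (fun y => g y `^ alpha * g y).
  apply: measurable_funM => //.
  by apply: (measurableT_comp (measurable_powR _)).
have p0 y : 0 <= g y `^ alpha * g y by rewrite mulr_ge0// powR_ge0.
have : 0 <= c by rewrite -lee_fin -Ec dirichlet_heat_ge0.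
rewrite le_eqVlt => /predU1P[<-|c0].
  by rewrite mulr0; exact: dirichlet_heat_ge0.
pose C := alpha * (c `^ alpha * c).
pose D := (1 + alpha) * c `^ alpha.
have C0 : 0 <= C by rewrite !mulr_ge0 ?powR_ge0// ltW.
have D0 : 0 <= D by rewrite mulr_ge0 ?powR_ge0// addr_ge0// ltW.
have DC : D * c = c `^ alpha * c + C by rewrite /D /C; ring.
have K0 y : (0 <= (K t x y)%:E)%E by rewrite lee_fin dirichlet_kernel_ge0.
have KC : (\int[mu]_y (K t x y * C)%:E <= C%:E)%E.
  under eq_integral do rewrite mulrC EFinM.
  rewrite ge0_integralZl//; last exact/measurable_EFinP.
  by rewrite -[leRHS]mule1 lee_wpmul2l// integral_dirichlet_kernel_le1.
have : (D%:E * c%:E <=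
    dirichlet_heat t (fun y => g y `^ alpha * g y)%R x +
    \int[mu]_y (K t x y * C)%:E)%E.
  rewrite -Ec /dirichlet_heat -ge0_integralZl//; last 2 first.
  - exact: mKg.
  - by move=> y _; rewrite lee_fin mulr_ge0// dirichlet_kernel_ge0.
  rewrite -ge0_integralD//; last 4 first.
  - by move=> y _; rewrite lee_fin mulr_ge0// dirichlet_kernel_ge0.
  - exact: mKg.
  - by move=> y _; rewrite lee_fin mulr_ge0// dirichlet_kernel_ge0.
  - exact: (@mKg t x (cst C)).
  apply: ge0_le_integral => //.
  - move=> y _; rewrite -EFinM lee_fin (mulr_ge0 D0)//.
    by rewrite mulr_ge0// dirichlet_kernel_ge0.
  - by apply: measurable_funeM; exact: mKg.
  - by apply: emeasurable_funD; [exact: mKg|exact: (@mKg t x (cst C))].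
  move=> y _; rewrite -EFinM -EFinD lee_fin -mulrDr mulrCA.
  by rewrite ler_wpM2l ?dirichlet_kernel_ge0// powR_tangent.
move=> /le_trans/(_ (leeD2l _ KC)).
by rewrite -EFinM DC EFinD leeD2rE.
Qed.

End weissler.

Section lifespan.
Context {R : realType} (N m : nat).
Implicit Types (s t alpha c : R) (x y z : 'rV[R]_N) (f : 'rV[R]_N -> R).

Local Notation leb := (@lebesgue_measure R).
Local Notation mu := (@lebesgue_rV R N).
Local Notation Om := (@Omega R N m).
Local Notation K := (@dirichlet_kernel R N m).
Local Notation heat := (@dirichlet_heat R N m).

(** Turns the time integral over ]0, s[ into one over the whole line, so that Tonelli applies on the
    full product space. *)
Let cutoff s (g : R * 'rV[R]_N -> R) p := \1_(`]0, s[%classic : set R) p.1 * g p.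

Let integral_cutoff s r (g : R * 'rV[R]_N -> R) z :
  (\int[leb]_(sigma in `]0%R, s[) heat (r - sigma)%R (fun y => g (sigma, y)) z =
   \int[leb]_sigma heat (r - sigma)%R (fun y => cutoff s g (sigma, y)) z)%E.
Proof.
rewrite integral_mkcond; apply: eq_integral => sigma _.
rewrite patchE; case: ifPn => Ds.
  congr (heat _ _ _); apply/funext => y.
  by rewrite /cutoff indicE Ds mul1r.
rewrite /dirichlet_heat integral0_eq// => y _.
by rewrite /cutoff indicE (negbTE Ds) mul0r mulr0.
Qed.

Let cutoff_ge0 s (g : R * 'rV[R]_N -> R) p : (forall p, 0 <= g p) -> 0 <= cutoff s g p.
Proof. by move=> g0; rewrite mulr_ge0// indicE ler0n. Qed.

Let measurable_cutoff s (g : R * 'rV[R]_N -> R) : measurable_fun setT g ->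
  measurable_fun setT (cutoff s g).
Proof.
move=> mg; apply: measurable_funM => //.
have mD : measurable_fun setT (\1_(`]0, s[%classic : set R) : R -> R).
  exact: measurable_indic.
exact: (measurableT_comp mD).
Qed.

Let measurable_heat_cutoff s (g : R * 'rV[R]_N -> R) :
  measurable_fun setT g -> (forall p, 0 <= g p) ->
  measurable_fun setT (fun p : R * 'rV[R]_N =>
    heat (s - p.1) (fun y => cutoff s g (p.1, y)) p.2).
Proof.
move=> mg g0.
apply: (@measurable_dirichlet_heat R N m _ (R * 'rV[R]_N)%type
  (fun p => s - p.1) snd (fun w => cutoff s g (w.1.1, w.2))) => //.
- exact: measurable_funB.
- apply: (measurableT_comp (measurable_cutoff s mg)).
  by apply: measurable_fun_pair => //; exact: measurableT_comp.
- by move=> p; exact: cutoff_ge0.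
Qed.

Lemma measurable_duhamel s (g : R * 'rV[R]_N -> R) :
  measurable_fun setT g -> (forall p, 0 <= g p) ->
  measurable_fun setT (fun z => (\int[leb]_(sigma in `]0%R, s[)
    heat (s - sigma)%R (fun y => g (sigma, y)) z)%E).
Proof.
move=> mg g0; under eq_fun do rewrite integral_cutoff.
apply: (@measurable_fun_fubini_tonelli_G _ _ _ _ R leb
  (fun p : R * 'rV[R]_N => heat (s - p.1) (fun y => cutoff s g (p.1, y)) p.2)).
  exact: measurable_heat_cutoff.
by move=> p; apply: dirichlet_heat_ge0 => y; exact: cutoff_ge0.
Qed.

(** Tonelli brings the spatial integral inside, where the semigroup law adds the times t - s and s -
    sigma. *)
Lemma dirichlet_heat_duhamel s t (g : R * 'rV[R]_N -> R) x : 0 < s -> s < t ->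
  measurable_fun setT g -> (forall p, 0 <= g p) ->
  (\int[mu]_z ((K (t - s) x z)%:E *
     \int[leb]_(sigma in `]0%R, s[) heat (s - sigma)%R (fun y => g (sigma, y)) z) =
   \int[leb]_(sigma in `]0%R, s[) heat (t - sigma)%R (fun y => g (sigma, y)) x)%E.
Proof.
move=> s0 st mg g0.
rewrite [RHS]integral_cutoff.
pose Phi (p : R * 'rV[R]_N) := heat (s - p.1) (fun y => cutoff s g (p.1, y)) p.2.
have mPhi : measurable_fun setT Phi by exact: measurable_heat_cutoff.
have Phi0 p : (0 <= Phi p)%E.
  by apply: dirichlet_heat_ge0 => y; exact: cutoff_ge0.
pose F (p : R * 'rV[R]_N) := ((K (t - s) x p.2)%:E * Phi p)%E.
have mF : measurable_fun setT F.
  apply: emeasurable_funM => //; apply/measurable_EFinP.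
  exact: measurable_dirichlet_kernel.
have F0 p : (0 <= F p)%E by rewrite mule_ge0// lee_fin dirichlet_kernel_ge0.
transitivity (\int[mu]_z \int[leb]_sigma F (sigma, z))%E.
  apply: eq_integral => z _; rewrite integral_cutoff.
  rewrite /F/= ge0_integralZl.
  - by [].
  - by [].
  - exact: (measurableT_comp mPhi (pair2_measurable z)).
  - by move=> sigma _; exact: (Phi0 (sigma, z)).
  - by rewrite lee_fin dirichlet_kernel_ge0.
transitivity (\int[leb]_sigma \int[mu]_z F (sigma, z))%E.
  exact: (esym (@fubini_tonelli _ _ _ _ R leb mu F mF F0)).
apply: eq_integral => sigma _.
have [Ds|Ds] := boolP (sigma \in (`]0, s[%classic : set R)).
  have /andP[sigma0 sigmas] : 0 < sigma < s by move: Ds; rewrite inE/= in_itv.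
  have := @dirichlet_heat_semigroup R N m (t - s) (s - sigma)
    (fun y => cutoff s g (sigma, y)) x.
  rewrite !subr_gt0 addrA subrK; apply => // [|y]; last exact: cutoff_ge0.
  exact: (measurableT_comp (measurable_cutoff s mg) (pair1_measurable sigma)).
have hs y : cutoff s g (sigma, y) = 0 by rewrite /cutoff indicE/= (negbTE Ds) mul0r.
rewrite /F /Phi/= /dirichlet_heat integral0_eq ?integral0_eq// => [y _|z _].
  by rewrite hs mulr0.
rewrite integral0_eq ?mule0// => y _.
by rewrite hs mulr0.
Qed.

Lemma powR_heat_bound alpha t f (v : R -> 'rV[R]_N -> R) x A :
  0 < alpha -> 0 < t -> measurable_fun setT f -> (forall y, 0 <= f y) ->
  measurable_fun setT (fun p : R * 'rV[R]_N => v p.1 p.2) ->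
  (forall s y, 0 <= v s y) ->
  (forall s z, 0 < s -> s <= t -> Om z ->
    (v s z)%:E = (heat s f z + \int[leb]_(sigma in `]0%R, s[)
      heat (s - sigma)%R (fun y => v sigma y `^ alpha * v sigma y)%R z)%E) ->
  Om x -> heat t f x = A%:E -> alpha * t * A `^ alpha <= 1.
Proof.
move=> a0 t0 mf f0 mv v0 veq Ox EA.
pose g (p : R * 'rV[R]_N) := v p.1 p.2 `^ alpha * v p.1 p.2.
have mg : measurable_fun setT g.
  apply: measurable_funM => //.
  by apply: (measurableT_comp (measurable_powR _)).
have g0 p : 0 <= g p by rewrite mulr_ge0 ?powR_ge0.
have mvs s : measurable_fun setT (v s) by exact: (measurableT_comp mv (pair1_measurable s)).
have A0 : 0 <= A by rewrite -lee_fin -EA dirichlet_heat_ge0.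
move: A0; rewrite le_eqVlt => /predU1P[A0|A0].
  by rewrite -A0 powR0 ?gt_eqF// mulr0 ler01.
pose F sigma := heat (t - sigma) (fun y => g (sigma, y)) x.
have F0 sigma : (0 <= F sigma)%E by apply: dirichlet_heat_ge0 => y; exact: (g0 (_, _)).
have mF : measurable_fun setT F.
  apply: (@measurable_dirichlet_heat R N m _ R (fun sigma => t - sigma)
    (fun=> x) g) => //.
  exact: measurable_funB.
pose J s := (\int[leb]_(sigma in `]0%R, s[) F sigma)%E.
have J0 s : (0 <= J s)%E by apply: integral_ge0 => sigma _; exact: F0.
(* The only use of existence up to time [t]: as [v t x] is real, [J t] and with it all earlier [J s]
   are finite. *)
have Jt : (v t x)%:E = (A%:E + J t)%E by rewrite veq// EA.
have Jle a b : a <= b -> (J a <= J b)%E.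
  move=> ab; apply: ge0_subset_integral => //; first exact: measurable_funTS.
  move=> r /=; rewrite !in_itv/= => /andP[-> ra]/=.
  exact: lt_le_trans ab.
have Jfin s : s <= t -> J s \is a fin_num.
  move=> st; rewrite ge0_fin_numE//; apply: (le_lt_trans (Jle _ _ st)).
  rewrite ltey; apply/eqP => Jy; move: Jt; rewrite Jy addey//.
(* Defining [H] by its integral formula covers the endpoints 0 and [t]; [heatv] identifies it with
   the heat flow of [v s] in between. *)
pose H s := A + fine (J s).
have HJ s : s <= t -> (H s)%:E = (A%:E + J s)%E.
  by move=> st; rewrite EFinD fineK// Jfin.
have heatv s : 0 < s -> s < t -> heat (t - s) (v s) x = (H s)%:E.
  move=> s0 st; rewrite HJ ?ltW//.
  pose P z := (\int[leb]_(sigma in `]0%R, s[)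
    heat (s - sigma)%R (fun y => g (sigma, y)) z)%E.
  transitivity (\int[mu]_z ((K (t - s) x z)%:E * heat s f z +
      (K (t - s) x z)%:E * P z))%E.
    apply: eq_integral => z _.
    have [Oz|Oz] := pselect (Om z); last first.
      by rewrite dirichlet_kernel_out// mul0r !mul0e adde0.
    rewrite EFinM veq ?ltW// ge0_muleDr//; first exact: dirichlet_heat_ge0.
    by apply: integral_ge0 => sigma _; apply: dirichlet_heat_ge0 => y; exact: (g0 (_, _)).
  have K0 z : (0 <= (K (t - s) x z)%:E)%E by rewrite lee_fin dirichlet_kernel_ge0.
  have mK : measurable_fun setT (fun z => (K (t - s) x z)%:E).
    by apply/measurable_EFinP; exact: measurable_dirichlet_kernel.
  rewrite ge0_integralD.
  - by rewrite dirichlet_heat_semigroup ?subr_gt0// subrK EA dirichlet_heat_duhamel.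
  - by [].
  - by move=> z _; rewrite mule_ge0// dirichlet_heat_ge0.
  - apply: emeasurable_funM => //.
    apply: (@measurable_dirichlet_heat R N m _ _ (fun=> s) id (fun w => f w.2)) => //.
    exact: (measurableT_comp mf).
  - move=> z _; rewrite mule_ge0// integral_ge0// => sigma _.
    by apply: dirichlet_heat_ge0 => y; exact: (g0 (_, _)).
  - apply: emeasurable_funM => //.
    exact: measurable_duhamel.
apply: (powR_growth_time (H := H) a0 A0 (ltW t0)).
  by rewrite /H lerDl fine_ge0.
move=> a b a0' ab bt.
have at' := le_trans ab bt.
have Ha0 : 0 <= H a by rewrite addr_ge0 ?fine_ge0// ltW.
rewrite -lee_fin EFinD HJ// HJ// -addeA leeD2lE//.
(* By Jensen [F sigma] is at least H(sigma)^(1+alpha), and [H] is nondecreasing, so the value at [a]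
   bounds [F] below on the whole interval. *)
have step : (((b - a) * (H a `^ alpha * H a))%:E <= \int[leb]_(sigma in `]a, b[) F sigma)%E.
  have -> : (((b - a) * (H a `^ alpha * H a))%:E =
      \int[leb]_(sigma in `]a, b[) cst (H a `^ alpha * H a)%:E sigma)%E.
    rewrite integral_cst//= lebesgue_measure_itv/= lte_fin.
    move: ab; rewrite le_eqVlt => /predU1P[->|ab]; first by rewrite ltxx subrr mul0r mule0.
    by rewrite ab -EFinB -EFinM mulrC.
  apply: ge0_le_integral => //.
  - by move=> sigma _; rewrite lee_fin mulr_ge0 ?powR_ge0.
  - exact: measurable_funTS.
  move=> sigma; rewrite /= in_itv/= => /andP[asig sigb].
  have sig0 := le_lt_trans a0' asig; have sigt := lt_le_trans sigb bt.
  have tsig : 0 < t - sigma by rewrite subr_gt0.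
  have HaH : H a <= H sigma.
    by rewrite lerD2l fine_le ?Jfin ?Jle// ltW.
  have HH : ((H a `^ alpha * H a)%:E <= (H sigma `^ alpha * H sigma)%:E)%E.
    by rewrite lee_fin; exact: (powR_mul_le a0 Ha0 HaH).
  exact: (le_trans HH (dirichlet_heat_jensen a0 tsig (mvs sigma) (v0 sigma)
    (heatv _ sig0 sigt))).
apply: le_trans (leeD2l _ step) _.
(* Both open intervals miss the point [a]; inclusion of their union in ]0, b[ suffices for an
   inequality. *)
rewrite -ge0_integral_setU//; first last.
- apply/disj_setPS => r [] /=; rewrite !in_itv/= => /andP[_ ra] /andP[ar _].
  by have := lt_trans ra ar; rewrite ltxx.
- exact: measurable_funTS.
apply: ge0_subset_integral => //.
- exact: measurableU.
- exact: measurable_funTS.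
move=> r [] /=; rewrite !in_itv/= => /andP[r1 r2]; rewrite ?r1/=.
  exact: lt_le_trans ab.
by rewrite r2 andbT (le_lt_trans a0').
Qed.

End lifespan.

Section solution.
Context {R : realType} (N m : nat).
Implicit Types (s t alpha c : R) (x y z : 'rV[R]_N) (f : 'rV[R]_N -> R).

Local Notation leb := (@lebesgue_measure R).
Local Notation mu := (@lebesgue_rV R N).
Local Notation Om := (@Omega R N m).
Local Notation K := (@dirichlet_kernel R N m).
Local Notation heat := (@dirichlet_heat R N m).

(** Data are nonnegative only almost everywhere on Omega_m, and change sign across its walls when
    anti-symmetric. The absolute value is nonnegative everywhere and gives the same integral, the
    kernel being 0 off Omega_m. *)
Lemma heat_semigroup_ae_nonneg t f x : measurable_fun setT f ->
  {ae mu, forall y, Om y -> 0 <= f y} -> Om x ->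
  heat_semigroup m t f x = heat t (fun y => `|f y|) x.
Proof.
move=> mf f0 Ox; rewrite heat_semigroupE//.
have mK : measurable_fun setT (K t x) by exact: measurable_dirichlet_kernel.
apply: ae_eq_integral => //.
- by apply/measurable_EFinP/measurable_funM.
- by apply/measurable_EFinP/measurable_funM => //; exact: measurableT_comp.
apply: filterS f0 => y f0 _.
have [Oy|Oy] := pselect (Om y); first by rewrite ger0_norm// f0.
by rewrite dirichlet_kernel_out// !mul0r.
Qed.

Lemma uniform_cvg_at (u : R -> 'rV[R]_N -> R) s y :
  {uniform, u r @[r --> s] --> u s} -> u r y @[r --> s] --> u s y.
Proof.
move=> us.
have FF : Filter (u r @[r --> s]) by exact: fmap_filter.
have yT : [set y] `<=` setT by [].
have := @uniform_subset_cvg _ _ (u s) setT [set y] (u r @[r --> s]) FF yT us.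
by rewrite uniform_set1.
Qed.

(** Extension by 0 in time is needed because [is_solution] says nothing outside ]0, T[; the absolute
    value takes care of points off Omega_m. *)
Lemma solution_measurable alpha u0 T (u : R -> 'rV[R]_N -> R) :
  is_solution m alpha u0 T u ->
  measurable_fun setT (fun p : R * 'rV[R]_N =>
    if 0 < p.1 < T then `|u p.1 p.2| else 0).
Proof.
move=> sol; pose v s y := if 0 < s < T then `|u s y| else 0.
pose D : set R := `]0, T[%classic.
have mD : measurable D by exact: measurable_itv.
rewrite (_ : (fun _ => _) = (fun p : R * 'rV[R]_N => v p.1 p.2) \_ (D `*` setT)); last first.
  apply/funext => -[s y]; rewrite patchE /v/=.
  have -> : ((s, y) \in D `*` setT) = (0 < s < T).
    by apply/idP/idP; rewrite inE /D/= in_itv/=; [case|].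
  by case: ifP.
apply/(measurable_restrictT _ _).1; first exact: (measurableX mD measurableT).
apply: measurable_fun_separately => //.
  move=> s; have [sT|sT] := boolP (0 < s < T); last first.
    by rewrite (_ : v s = cst 0)//; apply/funext => y; rewrite /v (negbTE sT).
  rewrite (_ : v s = Num.norm \o u s); last by apply/funext => y; rewrite /v sT.
  have [[cu _] _ _ _ _] := sol s sT.
  by apply: measurableT_comp => //; exact: continuous_measurable_rV.
move=> s y; rewrite /D/= in_itv/= => sT.
have [_ us _ _ _] := sol s sT.
rewrite /v sT.
have : `|u r y| @[r --> s] --> `|u s y| by apply: cvg_norm; exact: uniform_cvg_at.
apply: cvg_trans; apply: near_eq_cvg.
have sD : s \in `]0, T[ by rewrite in_itv.
near=> r.
have : r \in `]0, T[ by near: r; exact: near_in_itvoo.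
by rewrite in_itv/= => ->.
Unshelve. all: by end_near. Qed.

Lemma solution_bound alpha (u0 : 'rV[R]_N -> R) T (u : R -> 'rV[R]_N -> R) t x : 0 < alpha ->
  measurable_fun setT u0 -> {ae mu, forall y, Om y -> 0 <= u0 y} ->
  is_solution m alpha u0 T u -> 0 < t < T -> Om x ->
  exists2 A, heat_semigroup m t u0 x = A%:E & alpha * t * A `^ alpha <= 1.
Proof.
move=> a0 mu0 u00 sol /andP[t0 tT] Ox.
have [_ _ _ _ eqt] := sol t (introT andP (conj t0 tT)).
pose v s y := if 0 < s < T then `|u s y| else 0.
have vE s y : 0 < s -> s < T -> Om y -> v s y = u s y.
  move=> s0 sT Oy; have sT' : 0 < s < T by rewrite s0.
  have [_ _ _ upos _] := sol s sT'.
  by rewrite /v sT' ger0_norm// upos.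
have hE sigma s z : 0 < sigma -> sigma < T -> Om z ->
    heat_semigroup m s (fun y => `|u sigma y| `^ alpha * u sigma y) z =
    heat s (fun y => v sigma y `^ alpha * v sigma y) z.
  move=> sig0 sigT Oz; rewrite heat_semigroupE//; apply: eq_integral => y _.
  have [Oy|Oy] := pselect (Om y); last by rewrite dirichlet_kernel_out// !mul0r.
  by rewrite /v sig0 sigT/= -[u sigma y]vE// /v sig0 sigT normr_id.
(* Duhamel's formula equates a real number with a sum of two nonnegative terms, so neither is
   infinite. *)
have hf : heat_semigroup m t u0 x \is a fin_num.
  have h0 : (0 <= heat_semigroup m t u0 x)%E.
    by rewrite heat_semigroup_ae_nonneg//; exact: dirichlet_heat_ge0.
  rewrite ge0_fin_numE// ltey; apply/eqP => hy.
  move: (eqt x Ox); rewrite hy addye// -ltNye.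
  apply: (@lt_le_trans _ _ 0%E) => //.
  apply: integral_ge0 => sigma; rewrite /= in_itv/= => /andP[sig0 sigt].
  rewrite hE//; last exact: lt_trans tT.
  apply: dirichlet_heat_ge0 => y; rewrite /v.
  by case: ifP; rewrite ?mulr0// mulr_ge0 ?powR_ge0.
exists (fine (heat_semigroup m t u0 x)); first by rewrite fineK.
apply: (@powR_heat_bound R N m alpha t (fun y => `|u0 y|) v x) => //.
- exact: measurableT_comp.
- exact: solution_measurable sol.
- by move=> s y; rewrite /v; case: ifP.
- move=> s z s0 st Oz; have sT := le_lt_trans st tT.
  have [_ _ _ _ eqs] := sol s (introT andP (conj s0 sT)).
  rewrite (vE _ _ s0 sT Oz) (eqs z Oz) (heat_semigroup_ae_nonneg _ mu0 u00 Oz).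
  apply: (congr1 (adde _)); apply: eq_integral => sigma.
  rewrite inE/= in_itv/= => /andP[sig0 sigs].
  by rewrite hE// (lt_trans sigs).
- by rewrite -heat_semigroup_ae_nonneg// fineK.
Qed.

End solution.

(** * Scaling, reflections and the profile psi0 *)

Section scaling_and_reflection.
Context {R : realType} {N : nat}.
Implicit Types (x y z : 'rV[R]_N) (f : 'rV[R]_N -> R).

Local Notation mu := (@lebesgue_rV R N).

(** The change of variables applied to the indicator of a null set shows that its preimage is
    null. *)
Lemma ae_rV_scale (d : 'I_N -> R) (P : 'rV[R]_N -> Prop) :
  (forall i, d i != 0) -> {ae mu, forall x, P x} ->
  {ae mu, forall x, P (rV_scale d x)}.
Proof.
move=> d0 [B [mB muB PB]].
have md := @measurable_rV_scale R N d.
have mS : measurable (rV_scale d @^-1` B).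
  by rewrite -[X in measurable X]setTI; exact: md.
exists (rV_scale d @^-1` B); split => //; last by move=> x; exact: PB.
have mB1 : measurable_fun setT (fun x => (\1_B x : R)%:E).
  by apply/measurable_EFinP; exact: measurable_indic.
have B0 x : (0 <= (\1_B x : R)%:E)%E by rewrite lee_fin indicE ler0n.
have := ge0_integral_rV_scale d0 mB1 B0.
have -> : (\int[mu]_x (\1_B x)%:E = 0)%E by rewrite integral_indic// setIT.
rewrite mule0 => <-.
transitivity (\int[mu]_x (\1_(rV_scale d @^-1` B) x)%:E)%E => //.
by rewrite integral_indic// setIT.
Qed.

Lemma reflectionE (i : 'I_N) :
  reflection i = rV_scale (fun j => if j == i then -1 else 1 : R).
Proof.
apply/funext => x; apply/rowP => j; rewrite !mxE.
by case: eqP => _; rewrite ?mulN1r ?mul1r.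
Qed.

Lemma scaleE (r : R) x : r *: x = rV_scale (fun=> r) x.
Proof. by apply/rowP => j; rewrite !mxE. Qed.

(** The hyperplane is a box with one factor of measure 0, and a product with 0 is 0 even when other
    factors are infinite. *)
Lemma ae_coord_neq0 (i : 'I_N) : {ae mu, forall x, x ord0 i != 0}.
Proof.
pose A (j : 'I_N) : set R := if j == i then [set 0] else setT.
have mA j : measurable (A j) by rewrite /A; case: ifP.
exists [set x : 'rV[R]_N | forall j, A j (x ord0 j)]; split.
- rewrite (_ : mkset _ = \bigcap_(j in [set: 'I_N])
      ((fun x : 'rV[R]_N => x ord0 j) @^-1` A j)); last first.
    by apply/seteqP; split => x /= Ax j; [move=> _|]; exact: Ax.
  apply: fin_bigcap_measurable => // j _.
  by rewrite -[X in measurable X]setTI; exact: measurable_coord.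
- rewrite lebesgue_rV_box// (bigD1 i)//= /A eqxx.
  by rewrite lebesgue_measure_set1 mul0e.
- move=> x /= /negP; rewrite negbK => /eqP xi j.
  by rewrite /A; case: eqP => // ->.
Qed.

(** The sign constraints are dropped one at a time, from the last coordinate down: points with x_i <
    0 are reflections of points already treated, and x_i = 0 is a null set. This transfers
    non-vanishing of omega from the whole space to Omega_m. *)
Lemma ae_eq0_Omega m f : (m <= N)%N -> ae_anti_symmetric m f ->
  {ae mu, forall x, Omega m x -> f x = 0} -> {ae mu, forall x, f x = 0}.
Proof.
move=> mN anti fm.
suff : forall k, (k <= m)%N -> {ae mu, forall x, Omega (m - k) x -> f x = 0}.
  by move=> /(_ m (leqnn m)); rewrite subnn; apply: filterS => x; apply.
elim => [_|k IH km]; first by rewrite subn0.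
have kN : (m - k.+1 < N)%N.
  by rewrite (leq_trans _ mN)// ltn_subrL/= (leq_trans _ km).
pose i := Ordinal kN.
have im : (i < m)%N by rewrite /= ltn_subrL/= (leq_trans _ km).
have E : (m - k = (m - k.+1).+1)%N by rewrite -subSn.
have {}IH := IH (ltnW km); rewrite E in IH.
have d0 j : (if j == i then -1 else 1 : R) != 0.
  by case: ifP => _; rewrite ?oppr_eq0 oner_eq0.
have Ir := ae_rV_scale d0 IH; rewrite -reflectionE in Ir.
apply: filterS3 (filterI IH Ir) (anti i im) (ae_coord_neq0 i) => x [fx frx] ax xi Ox.
move: xi; rewrite neq_lt => /orP[xi|xi].
  rewrite -[f x]opprK -ax frx ?oppr0// => j.
  rewrite ltnS leq_eqVlt => /orP[/eqP ji|ji].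
    have -> : j = i by exact/val_inj.
    by rewrite mxE eqxx oppr_gt0.
  rewrite mxE ifN ?Ox//; apply/eqP => jE.
  by move: ji; rewrite jE ltnn.
apply: fx => j; rewrite ltnS leq_eqVlt => /orP[/eqP ji|ji]; last exact: Ox.
by have -> : j = i by exact/val_inj.
Qed.

Lemma eucl_ge0 x : 0 <= eucl x. Proof. exact: sqrtr_ge0. Qed.

Lemma eucl_gt0 x i : x ord0 i != 0 -> 0 < eucl x.
Proof.
move=> xi; rewrite sqrtr_gt0 (bigD1 i)//= ltr_pwDl ?exprn_even_gt0//.
by apply: sumr_ge0 => j _; rewrite sqr_ge0.
Qed.

Lemma euclZ (r : R) x : 0 <= r -> eucl (r *: x) = r * eucl x.
Proof.
move=> r0; rewrite /eucl.
under eq_bigr do rewrite mxE exprMn.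
by rewrite -mulr_sumr sqrtrM ?sqr_ge0// sqrtr_sqr ger0_norm.
Qed.

Lemma measurable_eucl : measurable_fun setT (@eucl R N).
Proof.
rewrite (_ : @eucl R N = fun x => (\sum_i x ord0 i ^+ 2) `^ 2^-1); last first.
  by apply/funext => x; rewrite powR12_sqrt// sumr_ge0// => j _; rewrite sqr_ge0.
apply: (measurableT_comp (measurable_powR _)); apply: measurable_sum => i.
by apply: measurable_funX; exact: measurable_coord.
Qed.

Lemma measurable_psi0 m (gamma : R) : measurable_fun setT (@psi0 R N m gamma).
Proof.
apply: measurable_funM; first apply: measurable_funM => //.
  rewrite (_ : (fun x => _) = fun x : 'rV[R]_N =>
      \prod_(i < N) if (i < m)%N then x ord0 i else 1).
    by apply: measurable_prod => i _; case: (i < m)%N => //; exact: measurable_coord.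
  by apply/funext => x; rewrite big_mkcond.
apply: (measurableT_comp (measurable_powR _)); exact: measurable_eucl.
Qed.

Lemma psi0_gt0 m (gamma : R) x : (0 < m <= N)%N -> 0 < gamma -> Omega m x ->
  0 < psi0 m gamma x.
Proof.
move=> /andP[m0 mN] g0 Ox; rewrite /psi0 !mulr_gt0//.
- by apply: prodr_gt0 => k _; rewrite ltr_wpDr.
- by apply: prodr_gt0 => i im; exact: Ox.
- apply: powR_gt0; apply: (@eucl_gt0 _ (Ordinal (leq_trans m0 mN))).
  by rewrite gt_eqF// Ox.
Qed.

Lemma psi0Z m (gamma r : R) x : (m <= N)%N -> 0 < r ->
  psi0 m gamma (r *: x) = r `^ (- (gamma + m%:R)) * psi0 m gamma x.
Proof.
move=> mN r0; rewrite /psi0 euclZ ?ltW// powRM ?eucl_ge0 ?ltW//.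
have -> : \prod_(i < N | (i < m)%N) (r *: x) ord0 i =
    r ^+ m * \prod_(i < N | (i < m)%N) x ord0 i.
  under eq_bigr do rewrite mxE.
  by rewrite big_split/= -(big_ord_widen N (fun=> r) mN) prodr_const card_ord.
have -> : - (gamma + m%:R) = m%:R + (- gamma - 2 * m%:R) by ring.
rewrite (@powRD _ r m%:R); last by rewrite lt0r_neq0// implybT.
by rewrite powR_mulrn ?(ltW r0)//; ring.
Qed.

Lemma OmegaZ m (r : R) x : 0 < r -> Omega m x -> Omega m (r *: x).
Proof. by move=> r0 Ox i im; rewrite mxE mulr_gt0// Ox. Qed.

(** Local integrability off the origin yields measurability only there; the missing point is a
    measurable set. *)
Lemma measurable_funT_setC1 f : (0 < N)%N -> measurable_fun [set~ (0 : 'rV[R]_N)] f ->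
  measurable_fun setT f.
Proof.
move=> N0 mf.
have m0 : measurable [set 0 : 'rV[R]_N].
  rewrite (_ : [set 0] = \bigcap_(j in [set: 'I_N])
      ((fun x : 'rV[R]_N => x ord0 j) @^-1` [set 0])); last first.
    apply/seteqP; split => x /= => [-> j _|x0]; first by rewrite /= mxE.
    by apply/rowP => j; rewrite mxE; exact: x0.
  apply: fin_bigcap_measurable => // j _.
  by rewrite -[X in measurable X]setTI; exact: measurable_coord.
rewrite -(setUv [set 0 : 'rV[R]_N]) measurable_funU//; last exact: measurableC.
by split=> //; exact: measurable_fun_set1.
Qed.

End scaling_and_reflection.

(** * The heat flow under dilations *)

Section rescaling.
Context {R : realType} (N m : nat).
Implicit Types (r c : R) (x y z : 'rV[R]_N) (f g h : 'rV[R]_N -> R).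

Local Notation mu := (@lebesgue_rV R N).
Local Notation Om := (@Omega R N m).
Local Notation K := (@dirichlet_kernel R N m).
Local Notation heat := (@dirichlet_heat R N m).

Let mKg t x g : measurable_fun setT g ->
  measurable_fun setT (fun y => (K t x y * g y)%:E).
Proof.
move=> mg; apply/measurable_EFinP/measurable_funM => //.
exact: measurable_dirichlet_kernel.
Qed.

Let Kg0 t x g : (forall y, 0 <= g y) -> forall y, (0 <= (K t x y * g y)%:E)%E.
Proof. by move=> g0 y; rewrite lee_fin mulr_ge0// dirichlet_kernel_ge0. Qed.

Lemma dirichlet_heatZ t k g x : 0 <= k -> measurable_fun setT g ->
  (forall y, 0 <= g y) ->
  heat t (fun y => k * g y) x = (k%:E * heat t g x)%E.
Proof.
move=> k0 mg g0; rewrite /dirichlet_heat.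
under eq_integral do rewrite mulrCA EFinM.
rewrite ge0_integralZl//.
- exact: mKg.
- by move=> y _; exact: Kg0.
Qed.

Lemma ae_le_dirichlet_heat t g h x : measurable_fun setT g ->
  measurable_fun setT h -> (forall y, 0 <= g y) -> (forall y, 0 <= h y) ->
  {ae mu, forall y, Om y -> g y <= h y} -> (heat t g x <= heat t h x)%E.
Proof.
move=> mg mh g0 h0 gh; apply: ae_ge0_le_integral => //.
- by move=> y _; exact: Kg0.
- exact: mKg.
- by move=> y _; exact: Kg0.
- exact: mKg.
apply: filterS gh => y gh _; rewrite lee_fin.
have [Oy|Oy] := pselect (Om y); last by rewrite dirichlet_kernel_out// !mul0r.
by rewrite ler_wpM2l ?dirichlet_kernel_ge0// gh.
Qed.

Lemma dirichlet_heat_scale r g x : 0 < r -> measurable_fun setT g ->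
  (forall y, 0 <= g y) ->
  heat (r ^+ 2) g (r *: x) = heat 1 (fun z => g (r *: z)) x.
Proof.
move=> r0 mg g0.
have rN : 0 < r ^+ N by rewrite exprn_gt0.
have mgr : measurable_fun setT (fun z => g (r *: z)).
  under eq_fun do rewrite scaleE.
  by apply: (measurableT_comp mg); exact: measurable_rV_scale.
have := @ge0_integral_rV_scale R N (fun=> r) _ (fun=> lt0r_neq0 r0)
  (mKg (r ^+ 2) (r *: x) mg) (Kg0 _ _ g0).
rewrite prodr_const card_ord gtr0_norm//.
rewrite (_ : (\int[mu]_y _)%E = ((r ^- N)%:E * heat 1 (fun z => g (r *: z)) x)%E); last first.
  rewrite -ge0_integralZl//.
  - apply: eq_integral => y _.
    by rewrite -scaleE dirichlet_kernel_scale// -EFinM mulrA.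
  - exact: mKg.
  - by move=> y _; rewrite lee_fin mulr_ge0// dirichlet_kernel_ge0.
  - by rewrite lee_fin invr_ge0 ltW.
move=> /(congr1 (fun e => (r ^+ N)%:E * e)%E).
by rewrite !muleA -EFinM mulfV ?gt_eqF// !mul1e => ->.
Qed.

(** The lower bound on the datum holds only at distance at least rho from the origin; seen after a
    dilation by r, it holds beyond rho / r. *)
Definition tail (d : R) h y : R := if d <= eucl y then h y else 0.

Lemma tail_ge0 d h y : (forall y, 0 <= h y) -> 0 <= tail d h y.
Proof. by move=> h0; rewrite /tail; case: ifP. Qed.

Lemma measurable_tail d h : measurable_fun setT h ->
  measurable_fun setT (tail d h).
Proof.
move=> mh; apply: measurable_fun_if => //; last exact: measurable_funTS.
by apply: measurable_fun_ler => //; exact: measurable_eucl.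
Qed.

Lemma tail_le d d' h y : (forall y, 0 <= h y) -> d' <= d ->
  tail d h y <= tail d' h y.
Proof.
move=> h0 dd; rewrite /tail; case: ifPn => [dy|_]; last by case: ifP.
by rewrite (le_trans dd).
Qed.

(** Monotone convergence: the tails beyond d / n increase to [h] away from the origin, which lies
    outside Omega_m as m > 0. The strict inequality is already reached at some finite n. *)
Lemma dirichlet_heat_tail h x c d : (0 < m <= N)%N ->
  measurable_fun setT h -> (forall y, 0 <= h y) -> 0 < d ->
  (c%:E < heat 1 h x)%E ->
  exists2 r0, 0 < r0 & forall r, r0 <= r -> (c%:E < heat 1 (tail (d / r) h) x)%E.
Proof.
move=> /andP[m0 mN] mh h0 d0 ch.
pose g n y := (K 1 x y * tail (d / n.+1%:R) h y)%:E.
have lim_g y : g^~ y @ \oo --> (K 1 x y * h y)%:E.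
  have [ey|ey] := ltP 0 (eucl y); last first.
    rewrite (_ : g^~ y = fun=> (K 1 x y * h y)%:E); first exact: cvg_cst.
    apply/funext => n; rewrite /g dirichlet_kernel_out ?mul0r// => Oy.
    have := @eucl_gt0 _ _ y (Ordinal (leq_trans m0 mN)).
    by rewrite ltNge ey gt_eqF ?Oy// => /(_ isT).
  have : (fun=> (K 1 x y * h y)%:E) @ \oo --> (K 1 x y * h y)%:E by exact: cvg_cst.
  apply: cvg_trans; apply: near_eq_cvg; near=> n; rewrite /g /tail ifT//.
  rewrite ler_pdivrMr// mulrC -ler_pdivrMr//.
  have /ltW : d / eucl y < n.+1%:R.
    rewrite (lt_trans (truncnS_gt _))// ltr_nat ltnS.
    by near: n; exact: nbhs_infty_gt.
  by [].
have cvg_int : (\int[mu]_y g n y)%E @[n --> \oo] --> heat 1 h x.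
  have -> : heat 1 h x = (\int[mu]_y limn (g^~ y))%E.
    by apply: eq_integral => y _; apply/esym/cvg_lim.
  apply: cvg_monotone_convergence => //.
  - by move=> n; apply: mKg; exact: measurable_tail.
  - by move=> n y _; apply: Kg0 => z; exact: tail_ge0.
  - move=> y _ n1 n2 n12; rewrite lee_fin ler_wpM2l ?dirichlet_kernel_ge0//.
    apply: tail_le => //; rewrite ler_wpM2l ?(ltW d0)//.
    by rewrite lef_pV2 ?posrE// ler_nat ltnS.
have [n cn] : exists n, (c%:E < \int[mu]_y g n y)%E.
  apply: contrapT => /forallNP cn; move: ch; rewrite ltNge => /negP; apply.
  apply: cvge_le cvg_int; apply: nearW => n.
  by rewrite leNgt; exact/negP/cn.
exists n.+1%:R => // r nr; apply: (lt_le_trans cn).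
have r0 : 0 < r by apply: lt_le_trans nr.
apply: ae_le_dirichlet_heat => //; do ?exact: measurable_tail.
- by move=> y; exact: tail_ge0.
- by move=> y; exact: tail_ge0.
apply: nearW => y _; apply: tail_le => //; rewrite ler_wpM2l ?(ltW d0)//.
by rewrite lef_pV2 ?posrE.
Unshelve. all: by end_near. Qed.

(** The kernel is strictly positive on Omega_m, so a vanishing integral would force [h] to vanish
    there. *)
Lemma dirichlet_heat_gt0 h x : measurable_fun setT h -> (forall y, 0 <= h y) ->
  Om x -> ~ {ae mu, forall y, Om y -> h y = 0} -> (0 < heat 1 h x)%E.
Proof.
move=> mh h0 Ox hN0; rewrite lt_neqAle dirichlet_heat_ge0// andbT.
apply/eqP => E0; apply: hN0.
have := (ae_eq_integral_abs mu measurableT (mKg 1 x mh)).1.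
under eq_integral do rewrite gee0_abs ?Kg0//.
move=> /(_ (esym E0)); apply: filterS => y /(_ Logic.I)/= [] /eqP.
rewrite mulf_eq0 => /orP[/eqP Ky Oy|/eqP//].
by have := dirichlet_kernel_gt0 (@ltr01 R) Ox Oy; rewrite Ky ltxx.
Qed.

Lemma dirichlet_heat_lower (gamma rho : R) (phi omega : 'rV[R]_N -> R) r x :
  (m <= N)%N -> 0 < r ->
  measurable_fun setT phi -> measurable_fun setT omega ->
  {ae mu, forall y, Om y -> rho <= eucl y ->
    omega y * psi0 m gamma y <= phi y} ->
  ae_homogeneous0 omega ->
  {ae mu, forall y, Om y -> 0 <= omega y} ->
  (0 < m)%N -> 0 < gamma ->
  ((r `^ (- (gamma + m%:R)))%R%:E *
     heat 1 (tail (rho / r)%R (fun y => `|omega y * psi0 m gamma y|%R)) x <=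
   heat (r ^+ 2)%R (fun y => `|phi y|%R) (r *: x)%R)%E.
Proof.
move=> mN r0 mphi momega lphi homega omega0 m0 gamma0.
have mh : measurable_fun setT (fun y => `|omega y * psi0 m gamma y|).
  apply: measurableT_comp => //; apply: measurable_funM => //.
  exact: measurable_psi0.
have mphi' : measurable_fun setT (fun y => `|phi y|) by exact: measurableT_comp.
rewrite dirichlet_heat_scale// -dirichlet_heatZ ?powR_ge0//; last 2 first.
- exact: measurable_tail.
- by move=> y; exact: tail_ge0.
apply: ae_le_dirichlet_heat.
- by apply: measurable_funM => //; exact: measurable_tail.
- under eq_fun do rewrite scaleE.
  by apply: (measurableT_comp mphi'); exact: measurable_rV_scale.
- by move=> y; rewrite mulr_ge0 ?powR_ge0 ?tail_ge0.
- by [].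
have := ae_rV_scale (fun=> lt0r_neq0 r0) lphi.
apply: filterS3 omega0 (homega r r0) => y om0 hom; rewrite -scaleE => lo Oy.
have [ry|ry] := leP (rho / r) (eucl y); last first.
  by rewrite /tail ifN ?mulr0// -ltNge.
rewrite /tail ry.
have Ory := OmegaZ r0 Oy.
have psi_gt0 : 0 < psi0 m gamma y by apply: psi0_gt0; rewrite ?m0.
rewrite ger0_norm; last by rewrite mulr_ge0 ?om0// ltW.
apply: le_trans (ler_norm _); apply: le_trans (lo Ory _); last first.
  by rewrite euclZ ?(ltW r0)// [r * _]mulrC -ler_pdivrMr.
by rewrite hom psi0Z// mulrCA.
Qed.

End rescaling.

(** * The life span *)

Section blow_up_time.
Context {R : realType}.

(** In logarithms both inequalities are linear and equivalent: the total exponent of r in the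
    hypothesis is 2 - alpha d = 2 alpha beta, positive by assumption. *)
Lemma powR_heat_bound_time (alpha d lambda c r : R) : 0 < alpha -> 0 < lambda ->
  0 < c -> 0 < r -> let beta := alpha^-1 - d / 2 in 0 < beta ->
  alpha * r ^+ 2 * (lambda * (r `^ (- d) * c)) `^ alpha <= 1 ->
  r ^+ 2 <= (lambda * (alpha `^ alpha^-1 * c)) `^ (- beta^-1).
Proof.
move=> a0 l0 c0 r0 beta b0.
have p0 : 0 < lambda * (r `^ (- d) * c) by rewrite !mulr_gt0 ?powR_gt0.
have q0 : 0 < lambda * (alpha `^ alpha^-1 * c) by rewrite !mulr_gt0 ?powR_gt0.
have r2 : 0 < r ^+ 2 by rewrite exprn_gt0.
have L0 : 0 < alpha * r ^+ 2 * (lambda * (r `^ (- d) * c)) `^ alpha.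
  by rewrite mulr_gt0 ?powR_gt0// mulr_gt0.
have rd0 : 0 < r `^ (- d) by exact: powR_gt0.
rewrite -ler_ln ?posrE// ln1 lnM ?posrE ?powR_gt0 ?mulr_gt0//.
rewrite lnM ?posrE// ln_powR lnM ?posrE ?mulr_gt0//.
rewrite [ln (_ * c)]lnM ?posrE// ln_powR lnXn// => H.
rewrite -ler_ln ?posrE ?powR_gt0// ln_powR lnXn//.
rewrite lnM ?posrE ?mulr_gt0 ?powR_gt0// lnM ?posrE ?powR_gt0// ln_powR.
rewrite mulNr -mulrN ler_pdivlMl//.
have -> : beta = (1 - alpha * d / 2) / alpha by rewrite /beta; field; rewrite gt_eqF.
have -> : - (ln lambda + (alpha^-1 * ln alpha + ln c)) =
  - (ln alpha + alpha * (ln lambda + ln c)) / alpha by field; rewrite gt_eqF.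
rewrite mulrAC ler_pM2r ?invr_gt0//.
by rewrite -mulr_natr in H *; lra.
Qed.

Variables (N m : nat) (alpha gamma : R) (phi omega : 'rV[R]_N -> R) (rho : R).

Local Notation mu := (@lebesgue_rV R N).
Local Notation Om := (@Omega R N m).
Local Notation heat := (@dirichlet_heat R N m).
Local Notation lifespan := (fun lambda => Tmax m alpha (fun x => lambda * phi x)).

Hypothesis mN : (0 < m <= N)%N.
Hypothesis gamma_gt0 : 0 < gamma.
Hypothesis alpha_gt0 : 0 < alpha.
Hypothesis mphi : measurable_fun setT phi.
Hypothesis phi_ge0 : {ae mu, forall x, Om x -> 0 <= phi x}.
Hypothesis rho_gt0 : 0 < rho.
Hypothesis phi_lower : {ae mu, forall x, Om x -> rho <= eucl x ->
  omega x * psi0 m gamma x <= phi x}.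
Hypothesis momega : measurable_fun setT omega.
Hypothesis homega : ae_homogeneous0 omega.
Hypothesis omega_ge0 : {ae mu, forall x, Om x -> 0 <= omega x}.

Let beta := alpha^-1 - (gamma + m%:R) / 2.
Hypothesis beta_gt0 : 0 < beta.

Let profile x := omega x * psi0 m gamma x.

Let E x := heat_semigroup m 1 profile x.

Let mprofile : measurable_fun setT profile.
Proof. by apply: measurable_funM => //; exact: measurable_psi0. Qed.

Let profile_ge0 : {ae mu, forall x, Om x -> 0 <= profile x}.
Proof.
apply: filterS omega_ge0 => x om0 Ox.
by rewrite mulr_ge0 ?om0// ltW// psi0_gt0.
Qed.

Let EE x : Om x -> E x = heat 1 (fun y => `|profile y|) x.
Proof. by move=> Ox; rewrite /E heat_semigroup_ae_nonneg. Qed.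

(** [tau] is chosen before [lambda]: it is the time after which the tail of the profile still yields
    more than [c] at [x]. *)
Lemma lifespan_le x c : Om x -> 0 < c -> (c%:E < E x)%E ->
  exists tau : R, forall lambda, 0 < lambda ->
  (lifespan lambda <= (Num.max tau
    ((lambda * (alpha `^ alpha^-1 * c)) `^ (- beta^-1)))%:E)%E.
Proof.
move=> Ox c0; rewrite EE// => cE.
have mabs : measurable_fun setT (fun y => `|profile y|).
  exact: measurableT_comp.
have [r0 r00 Hr0] := dirichlet_heat_tail mN mabs (fun y => normr_ge0 _) rho_gt0 cE.
exists (r0 ^+ 2) => lambda lambda0; apply: ge_ereal_sup => _ [T [T0 [u sol]] <-].
rewrite lee_fin leNgt; apply/negP.
set M := Num.max _ _ => MT.
have M0 : 0 < M by rewrite lt_max exprn_gt0.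
pose t := (M + T) / 2; pose r := Num.sqrt t.
have Mt : M < t by rewrite /t; lra.
have tT : t < T by rewrite /t; lra.
have t0 : 0 < t by exact: lt_trans Mt.
have r_gt0 : 0 < r by rewrite sqrtr_gt0.
have rt : r ^+ 2 = t by rewrite sqr_sqrtr// ltW.
have r0r : r0 <= r.
  rewrite -(@ler_pXn2r _ 2) ?nnegrE ?(ltW r00) ?(ltW r_gt0)// rt.
  by rewrite (le_trans _ (ltW Mt))// le_max lexx.
have mlphi : measurable_fun setT (fun x => lambda * phi x) by exact: measurable_funM.
have lphi_ge0 : {ae mu, forall x, Om x -> 0 <= lambda * phi x}.
  by apply: filterS phi_ge0 => y p0 Oy; rewrite mulr_ge0 ?p0// ltW.
have tT' : 0 < t < T by rewrite t0.
have Orx := OmegaZ r_gt0 Ox.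
have [A hA HA] := solution_bound alpha_gt0 mlphi lphi_ge0 sol tT' Orx.
have Alow : lambda * (r `^ (- (gamma + m%:R)) * c) <= A.
  rewrite -lee_fin -hA heat_semigroup_ae_nonneg//.
  rewrite (_ : (fun y => `|lambda * phi y|) = fun y => lambda * `|phi y|); last first.
    by apply/funext => y; rewrite normrM gtr0_norm.
  rewrite dirichlet_heatZ ?(ltW lambda0)//; last exact: measurableT_comp.
  rewrite !EFinM lee_wpmul2l ?lee_fin ?(ltW lambda0)// -rt.
  have [m0 mN'] := andP mN.
  apply: le_trans (dirichlet_heat_lower x mN' r_gt0 mphi momega phi_lower homega
    omega_ge0 m0 gamma_gt0).
  by rewrite lee_wpmul2l ?lee_fin ?powR_ge0// ltW// Hr0.
have lr0 : 0 <= lambda * (r `^ (- (gamma + m%:R)) * c).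
  by rewrite !mulr_ge0 ?powR_ge0// ltW.
have /(powR_heat_bound_time alpha_gt0 lambda0 c0 r_gt0 beta_gt0) :
    alpha * r ^+ 2 * (lambda * (r `^ (- (gamma + m%:R)) * c)) `^ alpha <= 1.
  apply: le_trans HA; rewrite rt.
  apply: (ler_wpM2l (mulr_ge0 (ltW alpha_gt0) (ltW t0))).
  by apply: (ge0_ler_powR (ltW alpha_gt0)); rewrite ?nnegrE// (le_trans lr0).
rewrite rt -/beta => tle.
by have := lt_le_trans Mt tle; rewrite ltNge /M le_max lexx orbT.
Qed.

Lemma lifespan_limsup_le x c : Om x -> 0 < c -> (c%:E < E x)%E ->
  (limf_esup (fun lambda : R => (lambda `^ beta^-1)%:E * lifespan lambda) 0^'+
   <= ((alpha `^ alpha^-1 * c) `^ (- beta^-1))%:E)%E.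
Proof.
move=> Ox c0 cE; have [tau Htau] := lifespan_le Ox c0 cE.
set D := alpha `^ alpha^-1 * c; have D0 : 0 < D by rewrite mulr_gt0 ?powR_gt0.
set q := D `^ (- beta^-1); have q0 : 0 < q by exact: powR_gt0.
(* [tau'] makes the threshold positive, and [e] is such that lambda < e keeps lambda^(1/beta) tau'
   below [q], the value produced by the other term of the maximum. *)
pose tau' := Num.max tau 1; have tau'0 : 0 < tau' by rewrite lt_max ltr01 orbT.
pose e := (q / tau') `^ beta; have e0 : 0 < e by rewrite powR_gt0// divr_gt0.
rewrite limf_esupE; apply: ge_ereal_inf.
exists (ereal_sup ((fun lambda : R => (lambda `^ beta^-1)%:E * lifespan lambda)%E @`
    [set lambda | 0 < lambda < e])).
  exists [set lambda | 0 < lambda < e] => //.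
  near=> lambda; apply/andP; split; near: lambda.
    exact: nbhs_right_gt.
  exact: nbhs_right_lt.
apply: ge_ereal_sup => _ [lambda /= /andP[l0 le] <-].
have lb : 0 < lambda `^ beta^-1 by exact: powR_gt0.
apply: (@le_trans _ _ ((lambda `^ beta^-1)%:E *
    (Num.max tau ((lambda * D) `^ (- beta^-1)))%:E)%E).
  by rewrite lee_wpmul2l ?lee_fin ?(ltW lb)//; exact: Htau.
rewrite -EFinM lee_fin -ler_pdivlMl// ge_max; apply/andP; split.
  rewrite ler_pdivlMl//; apply: (@le_trans _ _ (lambda `^ beta^-1 * tau')).
    by rewrite ler_wpM2l ?(ltW lb)// le_max lexx.
  rewrite -ler_pdivlMr//.
  have -> : q / tau' = e `^ beta^-1.
    by rewrite /e -powRrM mulfV ?gt_eqF// powRr1// divr_ge0// ltW.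
  apply: ge0_ler_powR; rewrite ?nnegrE ?invr_ge0 ?(ltW beta_gt0) ?(ltW l0) ?(ltW e0)//.
  exact: ltW.
rewrite powRM ?(ltW l0) ?(ltW D0)// [X in X * _ <= _]powRN.
by rewrite lexx.
Unshelve. all: by end_near. Qed.

Lemma sup_norm_gt c : 0 < c -> (c%:E < Linfty_norm Om E)%E ->
  exists2 x, Om x & (c%:E < E x)%E.
Proof.
move=> c0 cL; apply: contrapT => H; move: cL; rewrite ltNge => /negP; apply.
have HE x : (`|(E \_ Om) x| <= c%:E)%E.
  rewrite patchE; case: ifPn => [|_]; last by rewrite abse0 lee_fin ltW.
  rewrite inE => Ox; rewrite gee0_abs; last first.
    by rewrite EE//; exact: dirichlet_heat_ge0.
  by rewrite leNgt; apply/negP => cx; apply: H; exists x.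
rewrite /Linfty_norm unlock; case: ifP => _; last by rewrite lee_fin ltW.
by apply/ess_supP; exact: nearW.
Qed.

End blow_up_time.

Theorem theorem1p11 (R : realType) (N m : nat) (alpha gamma : R)
    (phi omega : 'rV[R]_N -> R) (rho : R) :
  (1 <= m <= N)%N ->
  0 < gamma < N%:R ->
  0 < alpha < 2 / (gamma + m%:R) ->
  L1loc [set~ 0] phi ->
  ae_anti_symmetric m phi ->
  calX m gamma phi ->
  {ae lebesgue_rV, forall x, Omega m x -> 0 <= phi x} ->
  0 < rho ->
  {ae lebesgue_rV, forall x, Omega m x -> rho <= eucl x ->
    omega x * psi0 m gamma x <= phi x} ->
  Linfty setT omega ->
  ae_homogeneous0 omega ->
  ae_anti_symmetric m omega ->
  {ae lebesgue_rV, forall x, Omega m x -> 0 <= omega x} ->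
  ~ {ae lebesgue_rV, forall x, omega x = 0} ->
  let beta := alpha^-1 - (gamma + m%:R) / 2 in
  (forall lambda : R, 0 < lambda ->
    (Tmax m alpha (fun x => lambda * phi x)%R < +oo)%E) /\
  (limf_esup (fun lambda : R =>
       (lambda `^ beta^-1)%:E * Tmax m alpha (fun x => lambda * phi x)%R)
     0^'+
   <= (((alpha `^ alpha^-1)%:E *
        Linfty_norm (Omega m)
          (heat_semigroup m 1 (fun x => omega x * psi0 m gamma x)%R))
       `^ beta^-1)^-1)%E.
Proof.
move=> /andP[m0 mN] /andP[gamma0 _] /andP[alpha0 alpha_lt] [mphi0 _ _] _ _.
move=> phi_ge0 rho0 phi_lower [momega _] homega anti omega_ge0 omegaN0 beta.
have mN' : (0 < m <= N)%N by rewrite m0.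
have mphi := measurable_funT_setC1 (leq_trans m0 mN) mphi0.
have gm0 : 0 < gamma + m%:R by rewrite ltr_wpDr.
have beta0 : 0 < beta.
  rewrite /beta subr_gt0 -invf_div ltf_pV2 ?posrE//.
  by rewrite divr_gt0.
have psi_gt0 (x : 'rV[R]_N) : Omega m x -> 0 < psi0 m gamma x by exact: (psi0_gt0 mN' gamma0).
have mprofile : measurable_fun setT (fun x : 'rV[R]_N => omega x * psi0 m gamma x).
  by apply: measurable_funM => //; exact: measurable_psi0.
have profile_ge0 :
    {ae lebesgue_rV, forall x, Omega m x -> 0 <= omega x * psi0 m gamma x}.
  by apply: filterS omega_ge0 => x om0 Ox; rewrite mulr_ge0 ?om0// ltW// psi_gt0.
pose E := heat_semigroup m 1 (fun x => omega x * psi0 m gamma x).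
have E_gt0 (x : 'rV[R]_N) : Omega m x -> (0 < E x)%E.
  move=> Ox; rewrite /E heat_semigroup_ae_nonneg//.
  apply: dirichlet_heat_gt0 => //; first exact: measurableT_comp.
  move=> h0; apply: omegaN0; apply: (ae_eq0_Omega mN anti).
  apply: filterS h0 => y hy Oy; move: (hy Oy) => /normr0_eq0/eqP.
  by rewrite mulf_eq0 (gt_eqF (psi_gt0 y Oy)) orbF => /eqP.
split.
  move=> lambda lambda0.
  have O1 : Omega m (const_mx 1 : 'rV[R]_N) by move=> i _; rewrite mxE.
  have [c c0 cE] : exists2 c : R, 0 < c & (c%:E < E (const_mx 1)%R)%E.
    have := E_gt0 _ O1; case: (E _) => [e|_|//].
      by rewrite lte_fin => e0; exists (e / 2); rewrite ?lte_fin; lra.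
    by exists 1; rewrite ?ltry.
  have [tau Htau] := lifespan_le mN' gamma0 alpha0 mphi phi_ge0 rho0 phi_lower
    momega homega omega_ge0 beta0 O1 c0 cE.
  exact: le_lt_trans (Htau _ lambda0) (ltry _).
set B := alpha `^ alpha^-1; have B0 : 0 < B by exact: powR_gt0.
set L := Linfty_norm _ _; set S := limf_esup _ _.
(* The bound of [lifespan_limsup_le] is a decreasing function of [c]; this inverts it, so that each
   [q] above the claimed bound corresponds to some [c] below [L]. *)
have key q : 0 < q -> ((q `^ (- beta) / B)%:E < L)%E -> (S <= q%:E)%E.
  move=> q0 cL; set c := q `^ (- beta) / B.
  have c0 : 0 < c by rewrite divr_gt0 ?powR_gt0.
  have [x Ox cE] := sup_norm_gt mN' gamma0 momega omega_ge0 c0 cL.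
  have := lifespan_limsup_le mN' gamma0 alpha0 mphi phi_ge0 rho0 phi_lower
    momega homega omega_ge0 beta0 Ox c0 cE.
  rewrite -/B /c [B * _]mulrC divfK ?gt_eqF// -powRrM mulrNN mulfV ?gt_eqF//.
  by rewrite (powRr1 (ltW q0)).
have L0 : (0 <= L)%E by exact: Lnorm_ge0.
have bi0 : beta^-1 != 0 by rewrite invr_eq0 gt_eqF.
(* For infinite [L] the right-hand side is 0 and [key] applies to every positive [e]; for [L] equal
   to 0 it is +oo. *)
case: L key L0 => [l key|key _|//]; last first.
  rewrite gt0_muley ?lte_fin// poweRyr// invey.
  by apply/lee_addgt0Pr => e e0; rewrite add0e key// ltry.
rewrite lee_fin le_eqVlt => /predU1P[<-|l0].
  by rewrite mule0 poweR0r// inve0 leey.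
have Bl : 0 < B * l by exact: mulr_gt0.
rewrite -EFinM poweR_EFin inver gt_eqF ?powR_gt0// -powRN.
set r := _ `^ _; have r0 : 0 < r by exact: powR_gt0.
apply/lee_addgt0Pr => e e0; rewrite -EFinD; apply: key; first exact: addr_gt0.
rewrite lte_fin ltr_pdivrMr// mulrC.
have -> : B * l = r `^ (- beta).
  by rewrite /r -powRrM mulrNN mulVf ?gt_eqF// powRr1// ltW.
rewrite !powRN ltf_pV2 ?posrE ?powR_gt0 ?addr_gt0//.
by apply: gt0_ltr_powR; rewrite ?nnegrE ?ltrDl// ltW// addr_gt0.
Qed.
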